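(* There exists a function $\alpha = \alpha(k) > 0$ with $\alpha(k) \to 0$ as $k \to \infty$ such that for every fixed integer $k \geq 2$ and every sufficiently large integer $n$ the following holds. If $q \geq (8e + \alpha) n/(k\log k)$ is an integer, then in the $(1:q)$ Waiter-Client game played on $E(K_n)$, Client has a strategy to ensure that his graph is $k$-colorable throughout the game. On the other hand, if $q \leq (\log 2/4 - \alpha) n/(k \log k)$ is a positive integer, then in the $(1:q)$ Waiter-Client game played on $E(K_n)$, Waiter has a strategy to force Client to build a non-$k$-colorable graph.
   Context: $\log$ denotes the natural logarithm. The $(1:q)$ Waiter-Client game on the board $E(K_n)$ is played as follows: in each round Waiter offers Client $q+1$ previously unoffered (free) edges; Client claims one of them and Waiter claims the remaining $q$. If in the final round only $1 \le r < q+1$ free edges remain, Client claims $\max\{0, r-q\}$ of them and Waiter claims the rest. The game ends when all edges are claimed. Client's graph is the graph on $V(K_n)$ formed by the edges Client claimed. *)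

(* Defs.v *)
From mathcomp Require Import all_boot.

Set Implicit Arguments.
Unset Strict Implicit.
Unset Printing Implicit Defensive.

Section WaiterClientGame.

Variables (T : finType) (board : {set T}) (q : nat).

(* A round (X, C): Waiter offered X, Client claimed C, Waiter claimed X :\: C.
   A history lists the rounds in chronological order. *)
Definition round : Type := ({set T} * {set T})%type.
Definition history : Type := seq round.

Definition offered (h : history) : {set T} := \bigcup_(r <- h) r.1.
Definition client_claimed (h : history) : {set T} := \bigcup_(r <- h) r.2.
Definition unoffered (h : history) : {set T} := board :\: offered h.

Definition game_over (h : history) : Prop := unoffered h = set0.

(* A round offers q + 1 unoffered elements, or all of them if at most q remain. *)
Definition legal_offer (h : history) (X : {set T}) : Prop :=
  [/\ unoffered h <> set0, X \subset unoffered h & #|X| = minn q.+1 #|unoffered h| ].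

(* The subtraction is truncated: this is 1 in a full round (#|X| = q + 1), and
   max {0, r - q} in a final round with #|X| = r < q + 1. *)
Definition legal_claim (X C : {set T}) : Prop :=
  C \subset X /\ #|C| = #|X| - q.

Inductive play : history -> Prop :=
| play_nil : play [::]
| play_round h X C :
    play h -> legal_offer h X -> legal_claim X C -> play (rcons h (X, C)).

Definition client_strategy : Type := history -> {set T} -> {set T}.
Definition waiter_strategy : Type := history -> {set T}.

Definition legal_client_strategy (s : client_strategy) : Prop :=
  forall h X, play h -> legal_offer h X -> legal_claim X (s h X).

Definition legal_waiter_strategy (s : waiter_strategy) : Prop :=
  forall h, play h -> ~ game_over h -> legal_offer h (s h).

Inductive client_play (s : client_strategy) : history -> Prop :=
| client_play_nil : client_play s [::]
| client_play_round h X :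
    client_play s h -> legal_offer h X ->
    client_play s (rcons h (X, s h X)).

Inductive waiter_play (s : waiter_strategy) : history -> Prop :=
| waiter_play_nil : waiter_play s [::]
| waiter_play_round h C :
    waiter_play s h -> ~ game_over h -> legal_claim (s h) C ->
    waiter_play s (rcons h (s h, C)).

Definition client_can_maintain (P : {set T} -> Prop) : Prop :=
  exists s : client_strategy, legal_client_strategy s /\
    forall h, client_play s h -> P (client_claimed h).

Definition waiter_can_force (P : {set T} -> Prop) : Prop :=
  exists s : waiter_strategy, legal_waiter_strategy s /\
    forall h, waiter_play s h -> game_over h -> P (client_claimed h).

End WaiterClientGame.

(* Edges of graphs on the vertex set 'I_n are the 2-element subsets. *)
Definition complete_edges (n : nat) : {set {set 'I_n}} :=
  [set e : {set 'I_n} | #|e| == 2].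

Definition colorable (n k : nat) (G : {set {set 'I_n}}) : Prop :=
  exists c : 'I_n -> 'I_k,
    forall x y : 'I_n, x != y -> [set x; y] \in G -> c x != c y.

(* Main.v *)
(** Client plays by derandomisation: claiming a uniformly random element of each
    offer does not increase the expected value of a potential, so Client's graph
    obeys every first moment bound of a random graph of density [1 / (q + 1)].
    Hence it has boundedly many triangles and is locally sparse. Outside a vertex
    set hitting all triangles, a variant of Shearer's bound gives independent sets
    of size [4 n / (3 k)] in every set of at least [n / sqrt k] vertices; these are
    peeled off as colour classes, and the sparse remainder is coloured greedily.
    For the finitely many small [k], [alpha k] is so large that Client's graph is
    a forest and Waiter's hypothesis on [q] is void.

    Waiter makes Client hit every clique on [ceil (n / k)] vertices, so that no
    colour class can be that large. The potential gives an unhit clique with [f]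
    free edges the weight [2 ^ (- f / q)]. Waiter offers [q + 1] edges at which the
    total weight is nearly constant, so that the gain at the edges that Waiter
    claims is paid for by the cliques that Client's edge hits. *)

Require Import Defs.
From mathcomp Require Import all_boot all_order all_algebra.
From mathcomp Require Import zify ring lra.
Import Order.TTheory GRing.Theory Num.Theory.
Set Implicit Arguments.
Unset Strict Implicit.
Unset Printing Implicit Defensive.
Local Open Scope ring_scope.

(** * Bookkeeping along a play *)

Section GameInvariants.

Variables (T : finType) (board : {set T}) (q : nat).

Lemma offered_rcons (h : history T) X C :
  offered (rcons h (X, C)) = offered h :|: X.
Proof. by rewrite /offered -cats1 big_cat /= big_seq1. Qed.

Lemma client_claimed_rcons (h : history T) X C :
  client_claimed (rcons h (X, C)) = client_claimed h :|: C.
Proof. by rewrite /client_claimed -cats1 big_cat /= big_seq1. Qed.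

Lemma offered_nil : offered ([::] : history T) = set0.
Proof. by rewrite /offered big_nil. Qed.

Lemma client_claimed_nil : client_claimed ([::] : history T) = set0.
Proof. by rewrite /client_claimed big_nil. Qed.

Lemma client_claimed_sub_offered h :
  play board q h -> client_claimed h \subset offered h.
Proof.
elim=> [|h' X C _ IH _ [sCX _]]; first by rewrite offered_nil client_claimed_nil.
by rewrite offered_rcons client_claimed_rcons setUSS.
Qed.

Lemma legal_offer_disjoint h X :
  legal_offer board q h X -> [disjoint X & offered h].
Proof.
case=> _ sX _; rewrite disjoint_subset; apply: subset_trans sX _.
by apply/subsetP=> x; rewrite !inE => /andP[].
Qed.

Lemma client_play_play s h :
  legal_client_strategy board q s -> client_play board q s h -> play board q h.
Proof.
move=> ls; elim=> [|h' X _ IH oX]; first exact: play_nil.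
by apply: play_round => //; apply: ls.
Qed.

Lemma waiter_play_play s h :
  legal_waiter_strategy board q s -> waiter_play board q s h -> play board q h.
Proof.
move=> ls; elim=> [|h' C _ IH ov lC]; first exact: play_nil.
by apply: play_round => //; apply: ls.
Qed.

Lemma client_can_maintain_mono (P Q : {set T} -> Prop) :
  (forall G, P G -> Q G) ->
  client_can_maintain board q P -> client_can_maintain board q Q.
Proof. by move=> PQ [s [ls Hs]]; exists s; split=> // h /Hs /PQ. Qed.

End GameInvariants.

(** * Client's potential strategy *)

Section ClientPotential.

Variables (R : realFieldType) (T : finType) (board : {set T}) (q : nat).
Variables (I : finType) (A : I -> {set T}) (lam : I -> R).
Hypothesis lam_ge0 : forall i, 0 <= lam i.

Let w : R := q.+1%:R^-1.

(** The conditional expectation of the weight of the sets that end up with Client if each element he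
    does not own yet joins him independently with probability [w]. A set is dead once it meets
    Waiter's part [O :\: C]. *)
Definition danger (O C : {set T}) : R :=
  \sum_i lam i * [disjoint A i & O :\: C]%:R * w ^+ #|A i :\: C|.

Lemma danger_term_ge0 i (O C : {set T}) :
  0 <= lam i * [disjoint A i & O :\: C]%:R * w ^+ #|A i :\: C|.
Proof. by rewrite !mulr_ge0 ?exprn_ge0 ?invr_ge0. Qed.

(* This is the expected value of [danger] when Client claims a uniformly random
   element of the offer [X]. *)
Lemma danger_average (O C X : {set T}) :
  C \subset O -> [disjoint X & O] -> #|X| = q.+1 ->
  \sum_(c in X) danger (O :|: X) (c |: C) <= q.+1%:R * danger O C.
Proof.
move=> sCO dXO cX; rewrite /danger exchange_big mulr_sumr; apply: ler_sum => i _.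
(* A set that misses [X] keeps its term under each of the [q + 1] choices. *)
case: (set_0Vmem (A i :&: X)) => [AX0|[c0 /setIP[c0A c0X]]].
  rewrite (eq_bigr (fun=> lam i * [disjoint A i & O :\: C]%:R * w ^+ #|A i :\: C|)).
    by rewrite sumr_const cX mulr_natl.
  move=> c cXin.
  have cA : c \notin A i.
    by apply/negP=> cA; have := in_set0 c; rewrite -AX0 inE cA cXin.
  have -> : A i :\: (c |: C) = A i :\: C.
    apply/setP=> x; rewrite !inE negb_or; case: eqP => [->|_] //=.
    by rewrite (negbTE cA) andbF.
  have -> // : [disjoint A i & (O :|: X) :\: (c |: C)] = [disjoint A i & O :\: C].
  rewrite -!setI_eq0; congr (_ == _); apply/setP=> x; rewrite !inE.
  case xA : (x \in A i) => //=; case xX : (x \in X).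
    by have := in_set0 x; rewrite -AX0 inE xA xX.
  by rewrite orbF; case: eqP => [xc|_] //; rewrite xc (negbTE cA) in xA.
(* Any choice other than [c0] hands [c0] to Waiter and kills the set; the choice [c0] multiplies its
   term by at most [q + 1]. *)
rewrite (bigD1 c0) //= big1 ?addr0; last first.
  move=> c /andP[cX' cc0].
  suff -> : [disjoint A i & (O :|: X) :\: (c |: C)] = false by rewrite mulr0 mul0r.
  apply/negbTE; rewrite -setI_eq0; apply/set0Pn; exists c0.
  rewrite !inE c0A c0X orbT andbT negb_or eq_sym cc0 /=.
  apply/negP=> c0C; have := subsetP sCO _ c0C.
  by rewrite (disjointFr dXO c0X).
have c0C : c0 \notin C.
  by apply/negP=> /(subsetP sCO); rewrite (disjointFr dXO c0X).
have E : #|A i :\: C| = #|A i :\: (c0 |: C)|.+1.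
  rewrite [LHS](cardsD1 c0) !inE c0A c0C /= add1n; congr (_.+1).
  by congr #|pred_of_set _|; apply/setP=> x; rewrite !inE negb_or andbA.
rewrite E exprS.
set b := [disjoint A i & O :\: C].
have -> : q.+1%:R * (lam i * b%:R * (w * w ^+ #|A i :\: (c0 |: C)|)) =
   lam i * b%:R * w ^+ #|A i :\: (c0 |: C)|.
  by rewrite [LHS](_ : _ = (q.+1%:R * w) * (lam i * b%:R * w ^+ #|A i :\: (c0 |: C)|));
    [rewrite divff ?mul1r // pnatr_eq0 | ring].
apply: ler_wpM2r; first by rewrite exprn_ge0 ?invr_ge0.
apply: ler_wpM2l => //; rewrite ler_nat /b.
case D : [disjoint A i & _ :\: (_ |: _)] => //.
rewrite -setI_eq0; suff -> : A i :&: (O :\: C) = set0 by rewrite eqxx.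
apply/setP=> x; rewrite !inE; apply/negbTE/negP=> /and3P[xA xC xO].
have /negP := disjointFr D xA; apply.
rewrite !inE xO /= andbT negb_or xC andbT.
by apply/eqP=> xc; rewrite xc in xO; rewrite (disjointFr dXO c0X) in xO.
Qed.

(** In a short final round Client is owed nothing, so the outer default [set0] is the legal claim.
    The inner default is ruled out by [danger_average]. *)
Definition potential_strategy : client_strategy T := fun h X =>
  if #|X| == q.+1 then
    if [pick c in X | danger (offered h :|: X) (c |: client_claimed h)
                       <= danger (offered h) (client_claimed h)] is Some c
    then [set c] else set0
  else set0.

Lemma potential_strategyP h X : play board q h -> legal_offer board q h X ->
  legal_claim q X (potential_strategy h X) /\
  danger (offered h :|: X) (client_claimed h :|: potential_strategy h X)
    <= danger (offered h) (client_claimed h).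
Proof.
move=> ph oX; have dX := legal_offer_disjoint oX.
have sC := client_claimed_sub_offered ph.
rewrite /potential_strategy; case: eqP => cX.
  case: pickP => [c /andP[cX' le]|none].
    by rewrite [client_claimed h :|: _]setUC; split=> //; split; rewrite ?sub1set // cards1 cX subSnn.
  have := danger_average sC dX cX.
  rewrite leNgt => /negP; case.
  rewrite -cX mulr_natl -sumr_const; apply: ltr_sum.
    have /card_gt0P[c cX'] : (0 < #|X|)%N by rewrite cX.
    by apply/hasP; exists c; rewrite // mem_index_enum.
  by move=> c cX'; have := none c; rewrite /= cX' /= leNgt => /negbFE.
have leX : (#|X| <= q)%N.
  by case: oX => _ _ E; move: E cX; rewrite minnE; lia.
rewrite setU0; split.
  by split; rewrite ?sub0set // cards0; apply/esym/eqP; rewrite subn_eq0.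
apply: ler_sum => i _; apply: ler_wpM2r; first by rewrite exprn_ge0 ?invr_ge0.
apply: ler_wpM2l => //; rewrite ler_nat.
case D : [disjoint A i & (_ :|: _) :\: _] => //.
by rewrite (disjointWr _ D) // setSD // subsetUl.
Qed.

(** [danger] starts at the right-hand side and never increases, while a set inside Client's graph
    contributes its full weight. The bound therefore holds at every moment of the game. *)
Lemma client_potential :
  client_can_maintain board q (fun G =>
    \sum_(i | A i \subset G) lam i <= \sum_i lam i * w ^+ #|A i|).
Proof.
have ls : legal_client_strategy board q potential_strategy.
  by move=> h X ph oX; case: (potential_strategyP ph oX).
exists potential_strategy; split=> // h hp.
have dh : danger (offered h) (client_claimed h) <= \sum_i lam i * w ^+ #|A i|.
  elim: hp => [|h' X hp IH oX].
    rewrite offered_nil client_claimed_nil; apply: ler_sum => i _.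
    by rewrite !setD0 disjoint_sym -setI_eq0 set0I eqxx mulr1.
  rewrite offered_rcons client_claimed_rcons; apply: le_trans IH.
  by case: (potential_strategyP (client_play_play ls hp) oX).
apply: le_trans dh; rewrite /danger big_mkcond; apply: ler_sum => i _.
case: ifP => [sA|_]; last exact: danger_term_ge0.
suff -> : [disjoint A i & offered h :\: client_claimed h].
  have /eqP-> : A i :\: client_claimed h == set0 by rewrite setD_eq0.
  by rewrite cards0 expr0 !mulr1.
by rewrite disjoint_sym disjoint_subset; apply/subsetP=> x; rewrite !inE => /andP[xC _];
   apply: contra xC => /(subsetP sA).
Qed.

End ClientPotential.

(** * Waiter's balancing strategy *)

Section WaiterPotential.

Variables (R : realFieldType) (T : finType).

Lemma subset_of_card (A : {set T}) m : (m <= #|A|)%N ->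
  exists2 X : {set T}, X \subset A & #|X| = m.
Proof.
case/card_geqP=> s [us <- sA]; exists [set x in s].
  by apply/subsetP=> x; rewrite inE => /sA.
by rewrite cardsE; apply/card_uniqP.
Qed.

(** By convexity [x ^+ j] lies below its chord between [0] and [m]. For [x = lam], [m = q] and
    [lam ^+ q = 2] this reads [lam ^+ j <= 1 + j / q]. *)
Lemma exp_chord (x : R) j m : 1 <= x -> (j <= m)%N ->
  m%:R * (x ^+ j - 1) <= j%:R * (x ^+ m - 1).
Proof.
move=> x1; elim: m => [|m IH]; first by rewrite leqn0 => /eqP ->; rewrite !mul0r.
rewrite leq_eqVlt => /orP[/eqP-> //|]; rewrite ltnS => jm.
have H : x ^+ j - 1 <= j%:R * (x ^+ m.+1 - x ^+ m).
  rewrite subrX1 exprS.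
  have -> : j%:R * (x * x ^+ m - x ^+ m) = (x - 1) * (j%:R * x ^+ m) by ring.
  apply: ler_wpM2l; first by rewrite subr_ge0.
  rewrite mulr_natl -[X in _ *+ X]card_ord -sumr_const; apply: ler_sum => i _.
  by apply: ler_weXn2l => //; apply: ltnW; apply: leq_trans jm.
have := lerD (IH jm) H; rewrite -[m.+1%:R]natr1; lra.
Qed.

(** Cut the range from [0] to [r * d] into [r] intervals of length [d]: one of them receives [q + 1]
    values. The induction splits off the top interval. *)
Lemma pigeonhole_spread (f : T -> R) (d : R) q r (U : {set T}) :
  (0 < r)%N -> (r * q.+1 <= #|U|)%N ->
  (forall x, x \in U -> 0 <= f x <= r%:R * d) ->
  exists X : {set T}, [/\ X \subset U, #|X| = q.+1 &
    forall x y, x \in X -> y \in X -> f y - f x <= d].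
Proof.
elim: r U => // r IH U _ cU fU; case: r IH cU fU => [|r] IH cU fU.
  rewrite mul1n in cU; have [X sX cX] := subset_of_card cU.
  exists X; split=> // x y /(subsetP sX)/fU/andP[? _] /(subsetP sX)/fU/andP[_].
  by rewrite mul1r => ?; lra.
pose U1 := [set x in U | r.+1%:R * d <= f x].
case: (leqP q.+1 #|U1|) => c1.
  have [X sX cX] := subset_of_card c1; exists X; split=> //.
    by apply: subset_trans sX _; apply/subsetP=> x; rewrite inE => /andP[].
  move=> x y /(subsetP sX); rewrite inE => /andP[_ lx] /(subsetP sX).
  by rewrite inE => /andP[/fU/andP[_ +] _]; rewrite -[r.+2%:R]natr1; lra.
have [||x|X [sX cX sp]] := IH (U :\: U1) => //.
- rewrite cardsD (setIidPr _); first by move: cU c1; rewrite !mulSn; lia.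
  by apply/subsetP=> x; rewrite inE => /andP[].
- rewrite !inE => /andP[+ xU]; rewrite xU /= -ltNge => /ltW ->.
  by have /andP[->] := fU x xU.
by exists X; split=> //; apply: subset_trans sX (subsetDl _ _).
Qed.

Variables (board : {set T}) (q : nat) (I : finType) (A : I -> {set T}) (lam : R).
Hypotheses (q_gt0 : (0 < q)%N) (lam_ge1 : 1 <= lam) (lam_q : lam ^+ q = 2).
Hypothesis A_board : forall i, A i \subset board.

Let t (O C : {set T}) i : R := [disjoint A i & C]%:R * lam ^- #|A i :\: O|.

Definition unhit (O C : {set T}) : R := \sum_i t O C i.

Definition unhit_at (O C : {set T}) e : R := \sum_i t O C i * (e \in A i)%:R.

Let lam_gt0 : 0 < lam. Proof. exact: lt_le_trans ltr01 lam_ge1. Qed.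

Let t_ge0 O C i : 0 <= t O C i.
Proof. by rewrite mulr_ge0 // invr_ge0 exprn_ge0 // ltW. Qed.

Lemma unhit_ge0 O C : 0 <= unhit O C.
Proof. by apply: sumr_ge0 => i _; apply: t_ge0. Qed.

Lemma unhit_at_bounds O C e : 0 <= unhit_at O C e <= unhit O C.
Proof.
apply/andP; split; first by apply: sumr_ge0 => i _; rewrite mulr_ge0.
by apply: ler_sum => i _; case: (_ \in _); rewrite ?mulr1 ?mulr0.
Qed.

Lemma card_setD_offer (B O X : {set T}) : [disjoint X & O] ->
  #|B :\: O| = (#|B :\: (O :|: X)| + #|B :&: X|)%N.
Proof.
move=> dXO; rewrite -(cardsID X (B :\: O)) addnC; congr (_ + _)%N.
  by congr #|pred_of_set _|; apply/setP=> x; rewrite !inE negb_or andbA; do !case: (_ \in _).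
congr #|pred_of_set _|; apply/setP=> x; rewrite !inE.
by case xX: (x \in X); rewrite ?andbF // (disjointFr dXO xX).
Qed.

(** A set that avoids [c] and has [j] elements in [X] grows by the factor [lam ^+ j <= 1 + j / q]; a
    set through [c] is hit and disappears. Hence the change is at most the mean of
    [unhit_at f - unhit_at c] over the [q] other elements [f] of [X]. *)
Lemma unhit_full_round (O C X : {set T}) c (d : R) :
  [disjoint X & O] -> #|X| = q.+1 -> c \in X ->
  (forall x y, x \in X -> y \in X -> unhit_at O C y - unhit_at O C x <= d) ->
  unhit (O :|: X) (C :|: [set c]) <= unhit O C + d.
Proof.
move=> dXO cX cXin sp.
have q0 : q%:R != 0 :> R by rewrite pnatr_eq0 -lt0n.
have cXc : #|X :\ c| = q by move: cX; rewrite (cardsD1 c X) cXin => -[].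
apply: (@le_trans _ _ (unhit O C + q%:R^-1 *
    \sum_(f in X :\ c) (unhit_at O C f - unhit_at O C c))); last first.
  rewrite lerD2l mulrC ler_pdivrMr ?ltr0n // mulr_natr -[X in _ *+ X]cXc -sumr_const.
  by apply: ler_sum => f; rewrite !inE => /andP[_ fX]; apply: sp.
have -> : \sum_(f in X :\ c) (unhit_at O C f - unhit_at O C c) =
   \sum_i t O C i * \sum_(f in X :\ c) ((f \in A i)%:R - (c \in A i)%:R).
  rewrite (eq_bigr (fun f => \sum_i t O C i * ((f \in A i)%:R - (c \in A i)%:R))).
    by rewrite exchange_big /=; apply: eq_bigr => i _; rewrite mulr_sumr.
  by move=> f _; rewrite /unhit_at -sumrB; apply: eq_bigr => i _; rewrite mulrBr.
rewrite mulr_sumr -big_split /=; apply: ler_sum => i _.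
set S := \sum_(f in X :\ c) _.
have -> : t O C i + q%:R^-1 * (t O C i * S) = t O C i * (1 + S / q%:R) by ring.
(* For a set through [c], [1 + S / q] is the number of its other elements in [X] over [q], hence
   nonnegative; otherwise [S] is [#|A i :&: X|]. *)
case cA : (c \in A i).
  have -> : t (O :|: X) (C :|: [set c]) i = 0.
    rewrite /t; suff -> : [disjoint A i & C :|: [set c]] = false by rewrite mul0r.
    by apply/negP=> /disjointFr/(_ cA); rewrite !inE eqxx orbT.
  rewrite mulr_ge0 // /S cA sumrB sumr_const cXc mulrBl divff //.
  by rewrite addrC subrK mulr_ge0 ?invr_ge0 // sumr_ge0.
rewrite /t -mulrA.
have -> : [disjoint A i & C :|: [set c]] = [disjoint A i & C].
  by rewrite -!setI_eq0 setIUr setU_eq0 [X in _ && X]setI_eq0 disjoint_sym disjoints1 cA andbT.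
apply: ler_wpM2l => //.
rewrite (card_setD_offer (A i) dXO) exprD invfM -mulrA.
rewrite -[leLHS]mulr1; apply: ler_wpM2l; first by rewrite invr_ge0 exprn_ge0 // ltW.
rewrite mulrC ler_pdivlMr ?exprn_gt0 // mul1r.
have SE : S = #|A i :&: X|%:R.
  rewrite /S cA -sum1_card natr_sum big_mkcond [RHS]big_mkcond /=.
  apply: eq_bigr => f _; rewrite !inE subr0.
  by case: eqP => [->|_] /=; rewrite ?cA //; case: (f \in X); rewrite ?andbT ?andbF //; case: (_ \in _).
have jq : (#|A i :&: X| <= q)%N.
  rewrite -cXc; apply: subset_leq_card; apply/subsetP=> x; rewrite !inE.
  by case/andP=> xA ->; rewrite andbT; apply/eqP=> xc; rewrite -xc xA in cA.
have H := exp_chord lam_ge1 jq; rewrite lam_q in H.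
rewrite SE -(ler_pM2l (x := q%:R)) ?ltr0n //.
by rewrite [leRHS]mulrDr mulr1 mulrCA divff // mulr1; lra.
Qed.

(** At most [q] elements go to Waiter at once, so each weight grows by at most [lam ^+ q = 2]. *)
Lemma unhit_last_round (O C X : {set T}) : [disjoint X & O] -> (#|X| <= q)%N ->
  unhit (O :|: X) C <= 2 * unhit O C.
Proof.
move=> dXO cX; rewrite mulr_sumr; apply: ler_sum => i _.
rewrite /t mulrCA; apply: ler_wpM2l => //.
rewrite (card_setD_offer (A i) dXO) exprD invfM mulrCA.
rewrite -[leLHS]mulr1; apply: ler_wpM2l; first by rewrite invr_ge0 exprn_ge0 // ltW.
rewrite ler_pdivlMr ?exprn_gt0 // mul1r -lam_q; apply: ler_weXn2l => //.
by apply: leq_trans cX; apply: subset_leq_card; apply: subsetIr.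
Qed.

Let rounds (h : history T) := (#|unoffered board h| %/ q.+1)%N.

Definition balanced_offer (h : history T) (X : {set T}) : bool :=
  [&& X \subset unoffered board h, #|X| == q.+1 &
    [forall x in X, forall y in X,
       unhit_at (offered h) (client_claimed h) y -
       unhit_at (offered h) (client_claimed h) x
       <= unhit (offered h) (client_claimed h) / (rounds h)%:R]].

(** By pigeonhole a balanced offer exists as long as [q + 1] elements remain. With fewer there is
    none, and the fallback is the legal offer of all of them. *)
Definition balancing_strategy : waiter_strategy T := fun h =>
  if [pick X | balanced_offer h X] is Some X then X else unoffered board h.

Lemma balancing_strategyP h :
  if (q < #|unoffered board h|)%N then balanced_offer h (balancing_strategy h)
  else balancing_strategy h == unoffered board h.
Proof.
rewrite /balancing_strategy; case: ltnP => cU; last first.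
  case: pickP => // X /and3P[sX /eqP cX _].
  by have := subset_leq_card sX; rewrite cX leqNgt ltnS cU.
case: pickP => // none.
have r_gt0 : (0 < rounds h)%N by rewrite divn_gt0.
have [|X [sX cX sp]] := @pigeonhole_spread (unhit_at (offered h) (client_claimed h))
    (unhit (offered h) (client_claimed h) / (rounds h)%:R) q (rounds h)
    (unoffered board h) r_gt0 (leq_divM _ _).
  by move=> x _; rewrite mulrCA divff ?mulr1 ?unhit_at_bounds // pnatr_eq0 -lt0n.
have := none X; rewrite /= /balanced_offer sX cX eqxx /= => /negbT/negP; case.
by apply/forall_inP=> x xX; apply/forall_inP=> y yX; apply: sp.
Qed.

Lemma legal_balancing_strategy : legal_waiter_strategy board q balancing_strategy.
Proof.
move=> h _ nover; have := balancing_strategyP h; case: ltnP => cU.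
  by case/and3P=> sX /eqP cX _; split=> //; rewrite cX; apply/esym/minn_idPl.
by move=> /eqP ->; split=> //; apply/esym/minn_idPr; apply: leqW.
Qed.

Lemma unoffered_rcons (h : history T) X C :
  unoffered board (rcons h (X, C)) = unoffered board h :\: X.
Proof. by rewrite /unoffered offered_rcons setDDl. Qed.

(** With [r] full rounds left, a balanced round multiplies [unhit] by at most [(r + 1) / r], so
    [unhit * (r + 1)] does not increase. The factor 2 pays for a short last round. *)
Lemma waiter_potential :
  2 * (#|board| %/ q.+1).+1%:R * (\sum_i lam ^- #|A i|) < 1 ->
  waiter_can_force board q (fun G => forall i, ~~ [disjoint A i & G]).
Proof.
move=> small; set B := (#|board| %/ q.+1).+1%:R * (\sum_i lam ^- #|A i|).
exists balancing_strategy; split; first exact: legal_balancing_strategy.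
move=> h hp over.
(* The factor 2 is granted only once the board is exhausted. *)
have inv : unhit (offered h) (client_claimed h) * (rounds h).+1%:R
           <= (if #|unoffered board h| == 0%N then 2 else 1) * B.
  elim: hp {over} => [|h' C hp IH nover lC].
    have B0 : 0 <= B by rewrite mulr_ge0 // sumr_ge0 // => i _; rewrite invr_ge0 exprn_ge0 // ltW.
    rewrite offered_nil client_claimed_nil /rounds /unoffered offered_nil setD0 mulrC.
    apply: (@le_trans _ _ B); last by case: ifP => _; lra.
    apply: ler_wpM2l => //; apply: ler_sum => i _.
    by rewrite /t setD0 disjoint_sym -setI_eq0 set0I eqxx mul1r.
  have U0 : #|unoffered board h'| != 0%N.
    by apply/eqP=> /eqP; rewrite cards_eq0 => /eqP.
  rewrite (negbTE U0) mul1r in IH.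
  have dX := legal_offer_disjoint (legal_balancing_strategy
    (waiter_play_play legal_balancing_strategy hp) nover).
  have := balancing_strategyP h'.
  set X := balancing_strategy h' in dX lC *.
  rewrite offered_rcons client_claimed_rcons /rounds unoffered_rcons.
  case: ltnP => cU.
    case/and3P=> sX /eqP cX /forall_inP sp.
    have [sC cC] := lC; rewrite cX subSnn in cC.
    have /cards1P[c Cc] : #|C| == 1%N by rewrite cC.
    have cX' : c \in X by rewrite (subsetP sC) // Cc inE.
    have sp' x y : x \in X -> y \in X ->
       unhit_at (offered h') (client_claimed h') y -
       unhit_at (offered h') (client_claimed h') x
       <= unhit (offered h') (client_claimed h') / (rounds h')%:R.
      by move=> xX yX; have /forall_inP := sp x xX; apply.
    have le := unhit_full_round dX cX cX' sp'.
    rewrite Cc.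
    have cE : #|unoffered board h' :\: X| = (#|unoffered board h'| - q.+1)%N.
      by rewrite cardsD (setIidPr sX) cX.
    have r_gt0 : (0 < rounds h')%N by rewrite divn_gt0.
    have rE : ((#|unoffered board h'| - q.+1) %/ q.+1).+1 = rounds h'.
      by rewrite /rounds -[in RHS](subnKC cU) divnDl ?dvdnn // divnn.
    rewrite cE rE; apply: (@le_trans _ _ B).
      apply: le_trans IH.
      apply: le_trans (ler_wpM2r _ le) _ => //.
      by rewrite mulrDl divfK ?pnatr_eq0 -?lt0n // -natr1 mulrDr mulr1.
    have B0 : 0 <= B by apply: le_trans IH; rewrite mulr_ge0 // unhit_ge0.
    by case: ifP => _; lra.
  move=> /eqP XE; rewrite XE setDv cards0 eqxx div0n mulr1.
  have C0 : C = set0.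
    have [_ cC] := lC; rewrite XE in cC.
    by apply/eqP; rewrite -cards_eq0 cC subn_eq0.
  rewrite C0 setU0.
  have cX : (#|X| <= q)%N by rewrite XE.
  rewrite -XE; apply: le_trans (unhit_last_round _ dX cX) _.
  apply: ler_wpM2l => //; apply: le_trans IH.
  by rewrite ler_peMr ?unhit_ge0 // ler1n.
move=> i; apply/negP=> di.
move: over; rewrite /game_over => over.
move: inv; rewrite /rounds over cards0 eqxx div0n mulr1 => inv.
(* At the end a set that was never hit has no free element and weight exactly 1. *)
suff : 1 <= unhit (offered h) (client_claimed h).
  by move=> le1; have := le_trans le1 inv; rewrite /B mulrA leNgt small.
rewrite /unhit (bigD1 i) //= /t di mul1r.
have /eqP -> : A i :\: offered h == set0.
  by rewrite -subset0 -over setSD // A_board.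
by rewrite cards0 expr0 invr1 lerDl sumr_ge0 // => j _; apply: t_ge0.
Qed.

End WaiterPotential.

(** * Independent sets in triangle-free graphs *)

Section Graphs.

Variables (T : finType) (adj : rel T).
Hypotheses (adj_sym : symmetric adj) (adj_irr : irreflexive adj).
Implicit Types (A B S : {set T}) (x y z v : T).

Definition nbrs S v : {set T} := [set y in S | adj v y].

(** Ordered pairs are counted: [arcs S S] is the sum of the degrees inside [S], twice its number of
    edges. *)
Definition arcs A B : nat := (\sum_(x in A) #|nbrs B x|)%N.

Definition stable A : Prop := {in A &, forall x y, ~~ adj x y}.

Definition triangle_free S : Prop :=
  {in S & &, forall x y z, adj x y -> adj y z -> ~~ adj x z}.

(** Colours are natural numbers, so that two palettes are joined by a shift. *)
Definition set_colorable S (c : nat) : Prop :=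
  exists2 f : T -> nat, {in S, forall x, (f x < c)%N} &
    {in S &, forall x y, adj x y -> f x != f y}.

Lemma card_nbrs S v : #|nbrs S v| = (\sum_(y in S) adj v y)%N.
Proof.
rewrite -sum1_card big_mkcond [RHS]big_mkcond; apply: eq_bigr => y _.
by rewrite inE; case: (y \in S) => //=; case: (adj v y).
Qed.

Lemma arcsE A B : arcs A B = (\sum_(x in A) \sum_(y in B) adj x y)%N.
Proof. by apply: eq_bigr => x _; rewrite card_nbrs. Qed.

Lemma arcsC A B : arcs A B = arcs B A.
Proof.
rewrite !arcsE exchange_big; apply: eq_bigr => y _; apply: eq_bigr => x _.
by rewrite adj_sym.
Qed.

Lemma arcsIDl A B C : arcs A B = (arcs (A :&: C) B + arcs (A :\: C) B)%N.
Proof. by rewrite /arcs (big_setID C). Qed.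

Lemma arcsIDr A B C : arcs A B = (arcs A (B :&: C) + arcs A (B :\: C))%N.
Proof. by rewrite ![arcs A _]arcsC (arcsIDl B A C). Qed.

Lemma arcsS A B A' B' : A \subset A' -> B \subset B' -> (arcs A B <= arcs A' B')%N.
Proof.
move=> sA sB; rewrite (arcsIDl A' B' A) (setIidPr sA).
by rewrite (arcsIDr A B' B) (setIidPr sB) -addnA leq_addr.
Qed.

Lemma arcs_stable A : stable A -> arcs A A = 0%N.
Proof.
move=> stA; rewrite arcsE big1 // => x xA; rewrite big1 // => y yA.
by rewrite (negbTE (stA x y xA yA)).
Qed.

(** No arc has both ends in [A], so the arcs leaving [A] and those entering it are disjoint families
    of the same size. *)
Lemma arcs_setD_stable S A : A \subset S -> stable A ->
  (arcs (S :\: A) (S :\: A) + (arcs A S).*2)%N = arcs S S.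
Proof.
move=> sA stA; have := arcs_stable stA.
have E1 := arcsIDl S S A; have E2 := arcsIDr (S :\: A) S A; have E3 := arcsIDr A S A.
rewrite (setIidPr sA) in E1 E2 E3.
have E4 := arcsC (S :\: A) A; lia.
Qed.

Lemma set_colorableS S c d : (c <= d)%N -> set_colorable S c -> set_colorable S d.
Proof. by move=> cd [f f1 f2]; exists f => // x /f1 /leq_trans; apply. Qed.

Lemma set_colorableU A B c d : set_colorable A c -> set_colorable B d ->
  set_colorable (A :|: B) (c + d).
Proof.
move=> [f f1 f2] [g g1 g2].
exists (fun x => if x \in A then f x else c + g x)%N.
  move=> x; rewrite inE; case: ifP => xA /=; first by move=> _; have := f1 x xA; lia.
  by move=> /g1; lia.
move=> x y; rewrite !inE; case: ifP => xA; case: ifP => yA /= xB yB axy.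
- exact: f2.
- by have := f1 x xA; lia.
- by have := f1 y yA; lia.
- by have := g2 x y xB yB axy; rewrite eqn_add2l.
Qed.

Lemma set_colorable_stable A : stable A -> set_colorable A 1.
Proof. by move=> stA; exists (fun=> 0%N) => // x y xA yA; rewrite (negbTE (stA x y xA yA)). Qed.

Lemma missing_color (s : seq nat) d : (size s <= d)%N ->
  exists2 c, (c <= d)%N & c \notin s.
Proof.
move=> sd; have [/allP H|/allPn[c]] := boolP (all (mem s) (iota 0 d.+1)).
  by have := uniq_leq_size (iota_uniq 0 d.+1) H; rewrite size_iota ltnNge sd.
by rewrite mem_iota add0n ltnS /= => cd cs; exists c.
Qed.

(** Average degree below [d + 1] yields a vertex of degree at most [d]. Colour the rest by induction
    and give this vertex one of the [d + 1] colours missing at its neighbours. *)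
Lemma degenerate_colorable d S :
  (forall A : {set T}, A \subset S -> A != set0 -> (arcs A A < d.+1 * #|A|)%N) ->
  set_colorable S d.+1.
Proof.
move: {2}#|S| (erefl #|S|) => m; elim: m S => [|m IH] S cS H.
  by exists (fun=> 0%N) => // x y; rewrite (cards0_eq cS) inE.
have S0 : S != set0 by rewrite -cards_eq0 cS.
have [v vS dv] : exists2 v, v \in S & (#|nbrs S v| <= d)%N.
  apply/exists_inP; apply: contraLR (H S (subxx _) S0).
  rewrite negb_exists_in -leqNgt => /forall_inP le.
  rewrite mulnC -sum_nat_const; apply: leq_sum => x xS.
  by have := le x xS; rewrite -ltnNge.
have cSv : #|S :\ v| = m by move: cS; rewrite (cardsD1 v) vS => -[].
have [||f f1 f2] := IH (S :\ v) => //.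
  by move=> A sA; apply: H; apply: subset_trans sA (subsetDl _ _).
have [|c cd cn] := @missing_color [seq f y | y <- enum (nbrs S v)] d.
  by rewrite size_map -cardE.
have cN y : y \in S -> adj v y -> c != f y.
  move=> yS avy; apply: contraNneq cn => ->; apply: map_f.
  by rewrite mem_enum inE yS.
exists (fun x => if x == v then c else f x).
  by move=> x xS; case: eqP => [_|/eqP xv] //; apply: f1; rewrite !inE xv.
move=> x y xS yS axy; case: (eqVneq x v) => [xv|xv]; case: (eqVneq y v) => [yv|yv].
- by rewrite xv yv adj_irr in axy.
- by apply: cN => //; rewrite -xv.
- by rewrite eq_sym; apply: cN => //; rewrite -yv adj_sym.
- by apply: f2; rewrite // !inE ?xv ?yv.
Qed.

(** Stable sets of size at least [a] are removed one by one, each as a colour class, until fewer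
    than [mu] vertices are left. *)
Lemma peel_stable (a mu : nat) S : (0 < a)%N ->
  (forall A : {set T}, A \subset S -> (mu <= #|A|)%N ->
     exists2 B : {set T}, B \subset A & stable B /\ (a <= #|B|)%N) ->
  exists c, exists2 A : {set T}, A \subset S &
    [/\ (#|A| < mu)%N, (c * a <= #|S|)%N & set_colorable (S :\: A) c] .
Proof.
move=> a_gt0; move: {2}#|S|.+1 (ltnSn #|S|) => m; elim: m S => // m IH S cS H.
case: (ltnP #|S| mu) => cmu.
  exists 0%N, S => //; split=> //.
  by exists (fun=> 0%N) => [x|x y]; rewrite setDv inE.
have [B sB [stB aB]] := H S (subxx _) cmu.
have cB : #|S :\: B| = (#|S| - #|B|)%N by rewrite cardsD (setIidPr sB).
have leB := subset_leq_card sB.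
have [||c [A sA [cA ca colA]]] := IH (S :\: B).
- by rewrite cB; lia.
- by move=> A sA; apply: H; apply: subset_trans sA (subsetDl _ _).
exists c.+1, A; first by apply: subset_trans sA (subsetDl _ _).
split=> //; first by rewrite mulSn; lia.
have -> : S :\: A = B :|: ((S :\: B) :\: A).
  apply/setP=> x; rewrite !inE; case xB : (x \in B) => //=.
  have /negbTE -> : x \notin A by apply: contraL xB => /(subsetP sA); rewrite inE => /andP[].
  exact: subsetP sB _ xB.
exact: set_colorableU (set_colorable_stable stB) colA.
Qed.

(** * A discrete form of Shearer's bound *)

Section Shearer.

Variables (R : realFieldType) (p : nat).
Hypothesis p_gt0 : (0 < p)%N.

Let P : R := p%:R.
Let P_gt0 : 0 < P. Proof. by rewrite ltr0n. Qed.

(* A Riemann sum for [int_0^1 n^2 / (n + e t) dt = n^2 / e * ln (1 + e / n)]. *)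
Definition shearer_sum (n e : R) : R :=
  \sum_(i < p) n ^+ 2 / (P * n + e * i.+1%:R).

(** Bounds the drop of the [i]-th term of [shearer_sum] when a vertex is deleted with its [d]
    neighbours, whose degrees sum to [s]: [n] falls by [1 + d] and [e] by at least [2 * s]. *)
Let loss (n e d s : R) (i : nat) : R :=
  let th := n / (P * n + e * i.+1%:R) in
  (2 * th - P * th ^+ 2) * (1 + d) - 2 * i.+1%:R * th ^+ 2 * s.

(* The tangent inequality [m^2 / L >= 2 m th - th^2 L] of the convex function
   [m^2 / L]. *)
Lemma shearer_term_removal (n e d s m e' : R) (i : nat) :
  0 < n -> 0 <= e -> m = n - 1 - d -> 0 <= m -> 0 <= e' -> e' <= e - 2 * s ->
  n ^+ 2 / (P * n + e * i.+1%:R) - loss n e d s i <= m ^+ 2 / (P * m + e' * i.+1%:R).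
Proof.
move=> n0 e0 mE m0 e'0 le'; rewrite /loss /=; set j : R := i.+1%:R.
have j0 : 0 < j by rewrite ltr0n.
set L := P * n + e * j; set L' := P * m + e' * j.
have L0 : 0 < L by apply: ltr_wpDr; [apply: mulr_ge0 => //; apply: ltW | apply: mulr_gt0].
have L'0 : 0 <= L' by rewrite addr_ge0 // mulr_ge0 // ltW.
set th := n / L.
have th0 : 0 < th by rewrite divr_gt0.
have tangent : 2 * m * th - th ^+ 2 * L' <= m ^+ 2 / L'.
  (* For [m = 0] the denominator [L'] may vanish; the right side is then 0 and the left side is not
     positive. *)
  case: (eqVneq m 0) => [->|mN0].
    rewrite expr0n /= mul0r mulr0 mul0r sub0r oppr_le0.
    by rewrite mulr_ge0 // exprn_ge0 // ltW.
  have L'p : 0 < L'.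
    by apply: ltr_wpDr; [apply: mulr_ge0 => //; apply: ltW | rewrite mulr_gt0 // lt_def mN0].
  rewrite ler_pdivlMr //; have := sqr_ge0 (m - th * L'); nra.
apply: le_trans tangent.
have -> : n ^+ 2 / L = 2 * th * n - th ^+ 2 * L by rewrite /th; field; rewrite gt_eqF.
have leL : th ^+ 2 * L' <= th ^+ 2 * (L - P * (1 + d) - 2 * j * s).
  apply: ler_wpM2l; first exact: sqr_ge0.
  have : e' * j <= (e - 2 * s) * j by apply: ler_wpM2r => //; apply: ltW.
  rewrite /L /L' mE; lra.
rewrite mE; lra.
Qed.

(** With [s2] the sum of the squared degrees, the left side is the [i]-th loss summed over all
    vertices. The right side telescopes over [i] to at most [n + n]. *)
Lemma shearer_loss (n e s2 : R) (i : nat) : 0 < n -> 0 <= e -> e ^+ 2 <= n * s2 ->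
  (2 * (n / (P * n + e * i.+1%:R)) - P * (n / (P * n + e * i.+1%:R)) ^+ 2) * (n + e)
   - 2 * i.+1%:R * (n / (P * n + e * i.+1%:R)) ^+ 2 * s2
  <= n / P + n ^+ 2 * P * ((P * n + e * i%:R)^-1 - (P * n + e * i.+1%:R)^-1).
Proof.
move=> n0 e0 es.
set j : R := i.+1%:R; have -> : i%:R = j - 1 :> R by rewrite /j -natr1 addrK.
have j1 : 1 <= j by rewrite ler1n.
set L := P * n + e * j; set L1 := P * n + e * (j - 1).
have Pn0 : 0 < P * n by rewrite mulr_gt0.
have L10 : 0 < L1.
  by apply: ltr_wpDr => //; rewrite mulr_ge0 // subr_ge0.
have L1L : L = L1 + e by rewrite /L /L1; ring.
have L0 : 0 < L by rewrite L1L; apply: ltr_wpDr.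
have s2e : e ^+ 2 / n <= s2 by rewrite ler_pdivrMr // mulrC.
apply: (@le_trans _ _ ((2 * (n / L) - P * (n / L) ^+ 2) * (n + e) -
   2 * j * (n / L) ^+ 2 * (e ^+ 2 / n))).
  rewrite lerD2l lerN2; apply: ler_wpM2l => //.
  by rewrite mulr_ge0 ?sqr_ge0 // mulr_ge0 //; lra.
have -> : (2 * (n / L) - P * (n / L) ^+ 2) * (n + e) - 2 * j * (n / L) ^+ 2 * (e ^+ 2 / n)
   = n ^+ 2 * (P * n + 2 * e * j) / L ^+ 2 + n ^+ 2 * P * (e / L ^+ 2).
  have E : e * j = L - P * n by rewrite /L; ring.
  have -> : 2 * j * (n / L) ^+ 2 * (e ^+ 2 / n) = 2 * (e * j) * (n / L) ^+ 2 * (e / n).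
    by ring.
  have -> : P * n + 2 * e * j = 2 * L - P * n by rewrite /L; ring.
  by rewrite E; field; rewrite !gt_eqF.
(* The first summand uses [P n (P n + 2 e j) <= (P n + e j)^2]; in the second, one factor [L] is
   lowered to [L1]. *)
apply: lerD.
  rewrite ler_pdivlMr // mulrAC ler_pdivrMr ?exprn_gt0 //.
  have -> : n ^+ 2 * (P * n + 2 * e * j) * P = n * (P * n * (P * n + 2 * e * j)) by ring.
  apply: ler_wpM2l; first exact: ltW.
  rewrite -subr_ge0 (_ : _ - _ = (e * j) ^+ 2) ?sqr_ge0 //; rewrite /L; ring.
apply: ler_wpM2l; first by rewrite mulr_ge0 ?sqr_ge0 // ltW.
have -> : L1^-1 - L^-1 = e / (L1 * L).
  by rewrite L1L; field; rewrite -L1L !gt_eqF.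
apply: ler_wpM2l => //; rewrite lef_pV2 ?posrE ?mulr_gt0 ?exprn_gt0 //.
by rewrite expr2 ler_pM2r // L1L lerDl.
Qed.

Lemma sum_nbrs_deg S :
  (\sum_(v in S) \sum_(x in nbrs S v) #|nbrs S x| = \sum_(x in S) #|nbrs S x| ^ 2)%N.
Proof.
rewrite (eq_bigr (fun v => \sum_(x in S) adj v x * #|nbrs S x|)%N); last first.
  move=> v _; rewrite big_mkcond [RHS]big_mkcond; apply: eq_bigr => x _.
  by rewrite inE; case: (x \in S) => //=; case: (adj v x); rewrite ?mul1n ?mul0n.
rewrite exchange_big; apply: eq_bigr => x xS /=.
rewrite -big_distrl /= -mulnn; congr (_ * _)%N; rewrite card_nbrs.
by apply: eq_bigr => v _; rewrite adj_sym.
Qed.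

(** Averaging: the losses of all vertices add up to at most [2 * n]. *)
Lemma shearer_vertex S : S != set0 ->
  exists2 v, v \in S &
    \sum_(i < p) loss #|S|%:R (arcs S S)%:R #|nbrs S v|%:R
       (\sum_(x in nbrs S v) #|nbrs S x|)%:R i <= 2.
Proof.
move=> S0; set n : R := #|S|%:R; set e : R := (arcs S S)%:R.
have n0 : 0 < n by rewrite ltr0n card_gt0.
have e0 : 0 <= e by [].
apply/exists_inP; rewrite -[X in is_true X]negbK negb_exists_in; apply/negP=> /forall_inP gt2.
set s2 : R := (\sum_(x in S) #|nbrs S x| ^ 2)%:R.
(* Cauchy-Schwarz, read off from the variance of the degrees. *)
have es : e ^+ 2 <= n * s2.
  have sq : 0 <= \sum_(x in S) (n * #|nbrs S x|%:R - e) ^+ 2 by apply: sumr_ge0 => x _; apply: sqr_ge0.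
  have E : \sum_(x in S) (n * #|nbrs S x|%:R - e) ^+ 2 = n ^+ 2 * s2 - n * e ^+ 2.
    rewrite (eq_bigr (fun x => n ^+ 2 * (#|nbrs S x| ^ 2)%:R - 2 * n * e * #|nbrs S x|%:R + e ^+ 2)); last first.
      by move=> x _; rewrite natrX; ring.
    rewrite big_split sumrB /= sumr_const -!mulr_sumr -!natr_sum -/s2.
    rewrite -[X in 2 * n * e * X]/e -mulr_natl -/n; ring.
  rewrite E in sq; rewrite -(ler_pM2l n0); move: sq; lra.
have : \sum_(v in S) \sum_(i < p) loss n e #|nbrs S v|%:R
       (\sum_(x in nbrs S v) #|nbrs S x|)%:R i <= 2 * n.
  rewrite exchange_big /=.
  apply: (@le_trans _ _ (\sum_(i < p) (n / P + n ^+ 2 * P *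
     ((P * n + e * i%:R)^-1 - (P * n + e * i.+1%:R)^-1)))).
    apply: ler_sum => i _; apply: le_trans (shearer_loss i n0 e0 es).
    rewrite /loss /= sumrB -!mulr_sumr -natr_sum sum_nbrs_deg -/s2.
    by rewrite big_split /= sumr_const -natr_sum.
  rewrite big_split /= sumr_const card_ord -mulr_sumr.
  have -> : n / P *+ p = n by rewrite -[n / P *+ p]mulr_natr divfK ?gt_eqF.
  rewrite -(big_mkord xpredT (fun i => (P * n + e * i%:R)^-1 - (P * n + e * i.+1%:R)^-1)).
  rewrite (@telescope_sumr_eq _ _ _ (fun i : nat => - (P * n + e * i%:R)^-1)) //; last by move=> i _; rewrite opprK addrC.
  rewrite mulr0 addr0 opprK.
  have H : 0 <= n ^+ 2 * P * (P * n + e * p%:R)^-1.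
    by rewrite !mulr_ge0 ?invr_ge0 ?addr_ge0 ?mulr_ge0 ?sqr_ge0 // ltW.
  have -> : n ^+ 2 * P * (- (P * n + e * p%:R)^-1 + (P * n)^-1) =
     n - n ^+ 2 * P * (P * n + e * p%:R)^-1.
    by rewrite mulrDr mulrN addrC; congr (_ - _); field; rewrite !gt_eqF.
  lra.
apply/negP; rewrite -ltNge mulr_natr -sumr_const; apply: ltr_sum.
  by have /set0Pn[v vS] := S0; apply/hasP; exists v; rewrite ?mem_index_enum.
by move=> v vS; rewrite ltNge gt2.
Qed.

Lemma nbrs_stable S v : triangle_free S -> v \in S -> stable (nbrs S v).
Proof.
move=> tf vS x y; rewrite !inE => /andP[xS avx] /andP[yS avy].
by apply: (tf x v y xS vS yS); rewrite // adj_sym.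
Qed.

(** Delete the vertex [v] of [shearer_vertex] with its neighbours and add [v] to a stable set of the
    rest: [2 * #|A|] gains 2 while the sum loses at most 2. *)
Lemma shearer S : triangle_free S ->
  exists2 A : {set T}, A \subset S &
    stable A /\ shearer_sum #|S|%:R (arcs S S)%:R <= 2 * #|A|%:R.
Proof.
move: {2}#|S|.+1 (ltnSn #|S|) => m; elim: m S => // m IH S cS tf.
case: (eqVneq S set0) => [->|S0].
  exists set0 => //; split; first by move=> x y; rewrite inE.
  rewrite cards0 mulr0 /shearer_sum big1 // => i _.
  by rewrite expr0n /= mul0r.
have [v vS le2] := shearer_vertex S0.
pose S' := S :\: (v |: nbrs S v).
have vN : v \notin nbrs S v by rewrite inE adj_irr andbF.
have sN : nbrs S v \subset S by apply/subsetP=> x; rewrite inE => /andP[].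
have sub : v |: nbrs S v \subset S by rewrite subUset sub1set vS.
have cS' : #|S| = (#|S'| + 1 + #|nbrs S v|)%N.
  rewrite -(cardsID (v |: nbrs S v) S) (setIidPr sub) cardsU1 vN; rewrite -/S'; lia.
have [||A sA [stA leA]] := IH S'.
- by lia.
- by move=> x y z /setDP[xS _] /setDP[yS _] /setDP[zS _]; apply: tf.
have nA x : x \in A -> x != v /\ ~~ adj v x.
  move=> /(subsetP sA); rewrite !inE negb_or => /andP[/andP[xv xN] xS].
  by split=> //; rewrite xS in xN.
have vA : v \notin A by apply/negP=> /nA[]; rewrite eqxx.
exists (v |: A).
  by rewrite subUset sub1set vS; apply: subset_trans sA (subsetDl _ _).
split.
  move=> x y; rewrite !inE => /orP[/eqP->|xA] /orP[/eqP->|yA].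
  - by rewrite adj_irr.
  - by case: (nA y yA).
  - by rewrite adj_sym; case: (nA x xA).
  - exact: stA.
rewrite cardsU1 vA natrD mulrDr mulr1.
apply: le_trans (lerD le2 leA).
rewrite addrC -lerBlDr -sumrB; apply: ler_sum => i _.
apply: shearer_term_removal => //.
- by rewrite ltr0n card_gt0.
- by rewrite cS' !natrD; ring.
(* In a triangle-free graph the neighbours of [v] form a stable set, so deleting them costs exactly
   twice the sum of their degrees. *)
- rewrite lerBrDr -natrM -natrD ler_nat.
  have <- := arcs_setD_stable sN (nbrs_stable tf vS).
  rewrite -muln2 [(2 * _)%N]mulnC leq_add2r; apply: arcsS;
    by apply: setDS; apply: subsetUr.
Qed.

End Shearer.

End Graphs.

(** * Graphs on the board *)

Definition edge_rel n (G : {set {set 'I_n}}) : rel 'I_n :=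
  fun x y => (x != y) && ([set x; y] \in G).

Definition inner_edges n (S : {set 'I_n}) : {set {set 'I_n}} :=
  [set e : {set 'I_n} | e \subset S & #|e| == 2%N].

Definition triangles n (G : {set {set 'I_n}}) : {set 'I_n * 'I_n * 'I_n} :=
  [set t | [&& edge_rel G t.1.1 t.1.2, edge_rel G t.1.2 t.2 & edge_rel G t.1.1 t.2]].

Section BoardGraphs.

Variable n : nat.
Implicit Types (G : {set {set 'I_n}}) (S W : {set 'I_n}) (x y z : 'I_n).

Lemma edge_rel_sym G : symmetric (edge_rel G).
Proof. by move=> x y; rewrite /edge_rel eq_sym setUC. Qed.

Lemma edge_rel_irr G : irreflexive (edge_rel G).
Proof. by move=> x; rewrite /edge_rel eqxx. Qed.

Lemma card_inner_edges S : #|inner_edges S| = 'C(#|S|, 2%N).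
Proof. exact: cards_draws. Qed.

Lemma set_colorable_colorable G k :
  set_colorable (edge_rel G) [set: 'I_n] k -> colorable k G.
Proof.
move=> [f f1 f2]; exists (fun x => Ordinal (f1 x (in_setT x))) => x y xy xyG.
by rewrite -val_eqE /=; apply: f2; rewrite ?inE // /edge_rel xy.
Qed.

(** Each arc gives an incidence of its first vertex with an edge, and an edge has two incidences. *)
Lemma arcs_le_edges G S :
  (arcs (edge_rel G) S S <= 2 * #|G :&: inner_edges S|)%N.
Proof.
apply: (@leq_trans (\sum_(x in S) \sum_(e in G :&: inner_edges S) (x \in e))%N).
  apply: leq_sum => x xS.
  have -> : (\sum_(e in G :&: inner_edges S) (x \in e) =
             #|[set e in G :&: inner_edges S | x \in e]|)%N.
    rewrite -sum1_card big_mkcond [RHS]big_mkcond; apply: eq_bigr => e _.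
    by rewrite inE; case: (e \in _) => //=; case: (x \in e).
  rewrite -(@card_in_imset _ _ (fun y => [set x; y]) (nbrs (edge_rel G) S x)).
    apply: subset_leq_card; apply/subsetP=> e /imsetP[y].
    rewrite inE => /andP[yS /andP[xy xyG]] ->.
    by rewrite !inE xyG eqxx subUset !sub1set xS yS cards2 xy.
  move=> y z; rewrite !inE => /andP[_ /andP[xy _]] /andP[_ /andP[xz _]] /setP E.
  have := E y; rewrite !inE eqxx orbT => /esym /orP[|/eqP //].
  by rewrite eq_sym (negbTE xy).
rewrite exchange_big /= mulnC -sum_nat_const; apply: leq_sum => e.
rewrite !inE => /and3P[_ _ /eqP <-]; rewrite -[X in (_ <= X)%N]sum1_card.
rewrite big_mkcond [X in (_ <= X)%N]big_mkcond; apply: leq_sum => x _.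
by case: (x \in S); case: (x \in e).
Qed.

Lemma triangle_hitting_set G :
  exists2 W : {set 'I_n}, (#|W| <= #|triangles G|)%N & triangle_free (edge_rel G) (~: W).
Proof.
exists [set t.1.1 | t in triangles G]; first exact: leq_imset_card.
move=> x y z; rewrite inE => xW _ _ xy yz; apply/negP=> xz.
by case/negP: xW; apply/imsetP; exists (x, y, z); rewrite // inE /= xy yz xz.
Qed.

Lemma card_triangle x y z : x != y -> y != z -> x != z ->
  #|[set [set x; y]; [set y; z]; [set x; z]]| = 3%N.
Proof.
move=> xy yz xz.
have d1 : [set x; y] != [set y; z].
  by apply/eqP=> /setP/(_ x); rewrite !inE eqxx (negbTE xy) (negbTE xz).
have d2 : [set x; y] != [set x; z].
  by apply/eqP=> /setP/(_ y); rewrite !inE eqxx orbT eq_sym (negbTE xy) (negbTE yz).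
have d3 : [set y; z] != [set x; z].
  by apply/eqP=> /setP/(_ y); rewrite !inE eqxx [y == x]eq_sym (negbTE xy) (negbTE yz).
by rewrite setUC cardsU1 cards2 d1 !inE negb_or ![[set x; z] == _]eq_sym d2 d3.
Qed.

Lemma sum_card_set (R : pzSemiRingType) (T : finType) (F : nat -> R) :
  \sum_(S : {set T}) F #|S| = \sum_(s < #|T|.+1) 'C(#|T|, s)%:R * F s.
Proof.
rewrite (partition_big (fun S : {set T} => inord #|S| : 'I_#|T|.+1) predT) //=.
apply: eq_bigr => s _; rewrite -card_draws mulr_natl -sumr_const.
apply: eq_big => [S|S].
  by rewrite inE -val_eqE /= inordK // ltnS max_card.
by rewrite -val_eqE /= inordK ?ltnS ?max_card // => /eqP ->.
Qed.

(** * First moment criteria for the two players *)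

Section ClientSparse.

Variables (R : realFieldType) (q : nat) (m : nat -> nat) (lam : R).
Hypothesis lam_ge0 : 0 <= lam.

Let w : R := q.+1%:R^-1.
Let idx : finType := ('I_n * 'I_n * 'I_n + {set 'I_n} * {set {set 'I_n}})%type.

Let bad (i : idx) : {set {set 'I_n}} := match i with
  | inl t => [set [set t.1.1; t.1.2]; [set t.1.2; t.2]; [set t.1.1; t.2]]
  | inr SE => SE.2
  end.

(** Degenerate triples and pairs that do not encode [m #|S|] edges inside [S] get weight 0, so that
    the index type stays a plain product and sum. *)
Let wt (i : idx) : R := match i with
  | inl t => if [&& t.1.1 != t.1.2, t.1.2 != t.2 & t.1.1 != t.2] then lam else 0
  | inr SE => if (SE.2 \subset inner_edges SE.1) && (#|SE.2| == m #|SE.1|) then 1 else 0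
  end.

(** One potential controls both properties: triangles weigh [lam] each, and a set [S] that is too
    dense would contain a family of edges of weight 1. *)
Lemma client_sparse :
  lam * n%:R ^+ 3 * w ^+ 3 +
    \sum_(s < n.+1) 'C(n, s)%:R * ('C('C(s, 2%N), m s)%:R * w ^+ m s) < 1 ->
  client_can_maintain (complete_edges n) q (fun G =>
    lam * #|triangles G|%:R < 1 /\
    forall S, (#|G :&: inner_edges S| < m #|S|)%N).
Proof.
move=> small.
have wt_ge0 i : 0 <= wt i by case: i => [t|SE] /=; case: ifP.
have w_ge0 : 0 <= w by rewrite invr_ge0.
apply: client_can_maintain_mono (@client_potential R _ (complete_edges n) q _ bad wt wt_ge0).
move=> G le.
have lt1 : \sum_(i | bad i \subset G) wt i < 1.
  apply: le_lt_trans le _; apply: le_lt_trans small.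
  rewrite big_sumType /=; apply: lerD.
    apply: (@le_trans _ _ (\sum_(t : 'I_n * 'I_n * 'I_n) lam * w ^+ 3)).
      apply: ler_sum => -[[x y] z] _ /=; case: ifP => [/and3P[xy yz xz]|_].
        by rewrite card_triangle.
      by rewrite mul0r mulr_ge0 ?exprn_ge0.
    rewrite sumr_const !card_prod !card_ord -[leLHS]mulr_natr !natrM.
    by rewrite le_eqVlt; apply/orP; left; apply/eqP; ring.
  have := sum_card_set 'I_n (fun s => 'C('C(s, 2%N), m s)%:R * w ^+ m s).
  rewrite card_ord => <-.
  rewrite -(pair_bigA _ (fun S (E : {set {set 'I_n}}) => (if (E \subset inner_edges S) && (#|E| == m #|S|)
      then 1 else 0) * w ^+ #|E|)) /=.
  apply: ler_sum => S _; rewrite -card_inner_edges -cards_draws mulr_natl -sumr_const.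
  rewrite [leRHS]big_mkcond; apply: ler_sum => E _; rewrite inE.
  by case: ifP => [/andP[_ /eqP ->]|_]; rewrite ?mul1r ?mul0r.
split.
  apply: le_lt_trans lt1; rewrite big_mkcond big_sumType /=.
  rewrite -[leLHS]addr0; apply: lerD; last first.
    by apply: sumr_ge0 => i _; case: ifP => // _; apply: (wt_ge0 (inr i)).
  rewrite mulr_natr -sumr_const big_mkcond; apply: ler_sum => -[[x y] z] _.
  rewrite inE /=; case: ifP => [|_]; last by case: ifP => // _; apply: (wt_ge0 (inl (x, y, z))).
  case/and3P=> /andP[xy xyG] /andP[yz yzG] /andP[xz xzG].
  by rewrite !subUset !sub1set xyG yzG xzG xy yz xz.
move=> S; rewrite ltnNge; apply/negP=> /subset_of_card[E sE cE].
suff : 1 <= \sum_(i | bad i \subset G) wt i by rewrite leNgt lt1.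
rewrite (bigD1 (inr (S, E))) /=; last by apply: subset_trans sE (subsetIl _ _).
rewrite (subset_trans sE (subsetIr _ _)) cE eqxx lerDl.
by apply: sumr_ge0.
Qed.

End ClientSparse.

(** As [s * k < n], some colour class has [s + 1] vertices; Client owns an edge inside it once he
    hits every clique of that size. *)
Lemma waiter_not_colorable (R : realFieldType) (k q s : nat) (lam : R) :
  (0 < q)%N -> 1 <= lam -> lam ^+ q = 2 -> (s * k < n)%N ->
  2 * (#|complete_edges n| %/ q.+1).+1%:R * ('C(n, s.+1)%:R * lam ^- 'C(s.+1, 2%N)) < 1 ->
  waiter_can_force (complete_edges n) q (fun G => ~ colorable k G).
Proof.
move=> q0 lam1 lamq skn small.
pose I : finType := {S : {set 'I_n} | #|S| == s.+1}.
pose A (i : I) := inner_edges (val i).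
have cA i : #|A i| = 'C(s.+1, 2%N).
  by rewrite card_inner_edges; case: i => S /= /eqP ->.
have sA i : A i \subset complete_edges n.
  by apply/subsetP=> e; rewrite !inE => /andP[].
have [|st [ls Hst]] := @waiter_potential R _ (complete_edges n) q I A lam q0 lam1 lamq sA.
  rewrite (eq_bigr (fun=> lam ^- 'C(s.+1, 2%N))); last by move=> i _; rewrite cA.
  rewrite sumr_const card_sig -[_ *+ #|_|]mulr_natl.
  suff -> : #|[pred x : {set 'I_n} | #|x| == s.+1]| = 'C(n, s.+1) by [].
  by have := card_draws 'I_n s.+1; rewrite card_ord cardsE.
exists st; split=> // h hp over [c cP].
have hit := Hst h hp over.
have [j cj] : exists j : 'I_k, (s.+1 <= #|[set x | c x == j]|)%N.
  apply/existsP; apply: contraLR skn; rewrite negb_exists => /forallP lt.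
  rewrite -leqNgt -[leqLHS]card_ord -sum1_card (partition_big c predT) //=.
  rewrite mulnC -[k in leqRHS]card_ord -sum_nat_const; apply: leq_sum => j _.
  have := lt j; rewrite -leqNgt; apply: leq_trans.
  by rewrite sum1_card cardsE.
have [S sS cS] := subset_of_card cj.
have cS' : #|S| == s.+1 by rewrite cS.
case/negP: (hit (Sub S cS')); rewrite /A SubK.
rewrite -setI_eq0; apply/eqP/setP=> e; rewrite !inE; apply/negbTE/negP.
case/andP=> /andP[eS /cards2P[x [y [xy eE]]]] eG; subst e.
have := cP x y xy eG; move: eS; rewrite subUset !sub1set => /andP[].
by move=> /(subsetP sS) + /(subsetP sS); rewrite !inE => /eqP -> /eqP ->; rewrite eqxx.
Qed.

End BoardGraphs.

(** Peeling outside [W] leaves fewer than [mu] vertices; these and [W] together are coloured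
    greedily with [d + 1] new colours. *)
Lemma sparse_colorable n (G : {set {set 'I_n}}) (W : {set 'I_n}) (a mu d k : nat) :
  triangle_free (edge_rel G) (~: W) -> (0 < a)%N ->
  (forall A : {set 'I_n}, triangle_free (edge_rel G) A -> (mu <= #|A|)%N ->
     exists2 B : {set 'I_n}, B \subset A & stable (edge_rel G) B /\ (a <= #|B|)%N) ->
  (forall A : {set 'I_n}, A != set0 -> (#|A| < mu + #|W|)%N ->
     (arcs (edge_rel G) A A < d.+1 * #|A|)%N) ->
  (forall c, (c * a <= n)%N -> (c + d.+1 <= k)%N) ->
  colorable k G.
Proof.
move=> tf a0 ind deg ck; apply: set_colorable_colorable.
have [||c [A sA [cA ca colA]]] := @peel_stable _ (edge_rel G) a mu (~: W) => //.
  move=> A sA; apply: ind => x y z xA yA zA.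
  by apply: tf; apply: (subsetP sA).
have -> : [set: 'I_n] = (~: W :\: A) :|: (A :|: W).
  by apply/setP=> x; rewrite !inE; case: (x \in A); case: (x \in W).
apply: set_colorableS (ck c _) _.
  by apply: leq_trans ca _; rewrite -[leqRHS]card_ord max_card.
apply: set_colorableU colA _; apply: degenerate_colorable.
- exact: edge_rel_sym.
- exact: edge_rel_irr.
move=> B sB B0; apply: deg => //; apply: leq_ltn_trans (subset_leq_card sB) _.
by apply: leq_ltn_trans (leq_card_setU A W) _; rewrite ltn_add2r.
Qed.

From mathcomp Require Import all_classical all_reals all_analysis.
Import numFieldNormedType.Exports.
Local Open Scope classical_set_scope.
Local Open Scope ring_scope.

(** * First moment bounds *)

Section Bounds.

Variable R : realType.
Implicit Types (n m s p : nat) (x e D : R).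

(** The terms decrease in [e], so [e = D * x] is the worst case. There [ln (1 + y) <= y] bounds each
    term below by a difference of logarithms. The sum telescopes, and [p + D <= 2 * p] costs the 2
    inside the logarithm. *)
Lemma shearer_sum_ge p x e D : 0 < x -> 0 < D -> 0 <= e <= D * x -> D <= p%:R ->
  x * ln ((1 + D) / 2) / D <= shearer_sum p x e.
Proof.
move=> x0 D0 /andP[e0 eD] Dp.
have p0 : 0 < p%:R :> R by exact: lt_le_trans D0 Dp.
pose g i : R := ln (p%:R + D * i.+1%:R).
have gp i : 0 < p%:R + D * i.+1%:R by apply: ltr_wpDr => //; rewrite mulr_ge0 // ltW.
apply: (@le_trans _ _ (\sum_(i < p) x / D * (g i.+1 - g i))).
  rewrite -mulr_sumr mulrAC; apply: ler_wpM2l; first by rewrite ltW // divr_gt0.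
  rewrite -(big_mkord xpredT (fun i => g i.+1 - g i)) telescope_sumr //.
  rewrite /g -ln_div ?posrE // ler_ln ?posrE ?divr_gt0 //; last by rewrite ltr_wpDr // ltW.
  rewrite mulr1 ler_pdivlMr ?ltr_wpDr ?(ltW D0) // mulrAC ler_pdivrMr //.
  rewrite -natr1; have := mulr_ge0 (ltW D0) (ltW p0).
  have : D * D <= D * p%:R by rewrite ler_pM2l.
  nra.
apply: ler_sum => i _.
have h1 : g i.+1 - g i <= D / (p%:R + D * i.+1%:R).
  rewrite /g -ln_div ?posrE //.
  have -> : (p%:R + D * i.+2%:R) / (p%:R + D * i.+1%:R) = 1 + D / (p%:R + D * i.+1%:R).
    rewrite -[i.+2%:R]natr1 mulrDr mulr1 addrA mulrDl divff ?gt_eqF //.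
  by apply: le_ln1Dx; apply: lt_trans (divr_gt0 D0 (gp i)); rewrite ltrN10.
apply: le_trans (ler_wpM2l _ h1) _; first by rewrite ltW // divr_gt0.
have -> : x / D * (D / (p%:R + D * i.+1%:R)) = x ^+ 2 / (p%:R * x + D * x * i.+1%:R).
  have -> : p%:R * x + D * x * i.+1%:R = x * (p%:R + D * i.+1%:R) by ring.
  by move: (gp i); set L := _ + _ => L0; field; rewrite !gt_eqF.
have px : 0 < p%:R * x by rewrite mulr_gt0.
apply: ler_wpM2l; first exact: sqr_ge0.
rewrite lef_pV2 ?posrE ?lerD2l ?ler_wpM2r //.
  by apply: ltr_wpDr => //; rewrite !mulr_ge0 // ltW.
by apply: ltr_wpDr => //; rewrite mulr_ge0.
Qed.

Lemma stable_set_ge (T : finType) (adj : rel T) (S : {set T}) D :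
  symmetric adj -> irreflexive adj -> triangle_free adj S -> (0 < #|S|)%N -> 0 < D ->
  (arcs adj S S)%:R <= D * #|S|%:R ->
  exists2 A : {set T}, A \subset S &
    stable adj A /\ #|S|%:R * ln ((1 + D) / 2) / D <= 2 * #|A|%:R.
Proof.
move=> sym irr tf S0 D0 le.
have [|A sA [stA leA]] := @shearer _ adj sym irr R (Num.truncn D).+1 _ S tf => //.
exists A => //; split=> //; apply: le_trans leA; apply: shearer_sum_ge => //.
- by rewrite ltr0n.
- by rewrite ler0n.
- by rewrite ltW // truncnS_gt.
Qed.

(** [m ^ m / m!] is one term of the exponential series at [m]. *)
Lemma exp_le_fact m : m%:R ^+ m <= expR 1 ^+ m * m`!%:R :> R.
Proof.
case: m => [|m]; first by rewrite !expr0 mul1r.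
have f0 : 0 < (m.+1)`!%:R :> R by rewrite ltr0n fact_gt0.
rewrite -expRM_natr mul1r -ler_pdivrMr //.
by have := @expR_ge1Dxn R m.+1%:R m (ler0n _ _); lra.
Qed.

(** The real bound [x] lets [s ^ 2 / 2] stand in for the number of pairs. *)
Lemma bin_le_exp n m x : n%:R <= x -> 'C(n, m)%:R <= (expR 1 * x / m%:R) ^+ m :> R.
Proof.
move=> nx; have x0 : 0 <= x by apply: le_trans nx.
case: m => [|m]; first by rewrite bin0 expr0.
have f0 : 0 < (m.+1)`!%:R :> R by rewrite ltr0n fact_gt0.
have m0 : 0 < m.+1%:R ^+ m.+1 :> R by rewrite exprn_gt0.
rewrite -(ler_pM2r f0) -natrM bin_ffact.
apply: (@le_trans _ _ (x ^+ m.+1)).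
  apply: (@le_trans _ _ (n%:R ^+ m.+1)); last by rewrite ler_pXn2r ?nnegrE.
  rewrite -natrX ler_nat; elim: m.+1 => [|j IH]; first by rewrite ffactn0.
  by rewrite ffactnSr expnSr leq_mul // leq_subr.
have -> : (expR 1 * x / m.+1%:R) ^+ m.+1 * (m.+1)`!%:R =
    x ^+ m.+1 * (expR 1 ^+ m.+1 * (m.+1)`!%:R / m.+1%:R ^+ m.+1).
  by rewrite !exprMn exprVn; ring.
by rewrite ler_peMr ?exprn_ge0 // ler_pdivlMr // mul1r exp_le_fact.
Qed.

Lemma first_moment_term n s m (w : R) : 0 <= w ->
  'C(n, s)%:R * ('C('C(s, 2%N), m)%:R * w ^+ m) <=
  (expR 1 * n%:R / s%:R) ^+ s * (expR 1 * s%:R ^+ 2 * w / (2 * m%:R)) ^+ m.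
Proof.
move=> w0; apply: ler_pM => //; first by rewrite mulr_ge0 ?exprn_ge0.
  exact: bin_le_exp.
have -> : expR 1 * s%:R ^+ 2 * w / (2 * m%:R) = (expR 1 * (s%:R ^+ 2 / 2) / m%:R) * w.
  by rewrite invfM; ring.
rewrite exprMn; apply: ler_wpM2r; first exact: exprn_ge0.
apply: bin_le_exp; rewrite ler_pdivlMr // -natrM -natrX ler_nat.
by rewrite mulnC mul_bin_left bin1 expnS expn1 leq_mul // leq_subr.
Qed.

Lemma sum_le_half (a : nat -> R) n : a 0%N <= 0 ->
  (forall s, (0 < s)%N -> a s <= 4^-1 ^+ s) -> \sum_(s < n.+1) a s <= 2^-1.
Proof.
move=> a0 aS.
(* The subtracted term provides the slack for the induction. *)
suff H : \sum_(s < n.+1) a s <= 2^-1 - 2^-1 * 4^-1 ^+ n.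
  apply: le_trans H _; rewrite gerBl mulr_ge0 // exprn_ge0 //.
elim: n => [|n IH]; first by rewrite big_ord_recl big_ord0 expr0 addr0 mulr1 subrr.
rewrite big_ord_recr /=; apply: le_trans (lerD IH (aS n.+1 isT)) _.
have : 0 <= (4^-1 : R) ^+ n by rewrite exprn_ge0.
rewrite exprS; lra.
Qed.

End Bounds.

(** * Client's side *)

(** Every nonempty set spans fewer edges than it has vertices, so Client's graph is a forest. *)
Lemma client_two_colorable (R : realType) n k q : (0 < n)%N -> (2 <= k)%N ->
  2 * expR 1 ^+ 2 * n%:R <= q%:R :> R ->
  client_can_maintain (complete_edges n) q (@colorable n k).
Proof.
move=> n0 k2 nq; set w : R := q.+1%:R^-1.
have w0 : 0 < w by rewrite invr_gt0 ltr0n.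
have e0 : 0 < expR 1 :> R by exact: expR_gt0.
have small : expR 1 ^+ 2 * n%:R * w / 2 <= 4^-1.
  rewrite ler_pdivrMr // /w ler_pdivrMr ?ltr0n // -[q.+1%:R]natr1; lra.
(* The empty set needs threshold 1, as nothing has fewer than 0 edges; [lam = 0] switches the
   triangles off. *)
have := @client_sparse n R q (maxn 1) 0 (lexx 0).
rewrite !mul0r add0r => sparse.
apply: client_can_maintain_mono (sparse _).
  move=> G [_ sp]; apply: set_colorable_colorable.
  apply: (set_colorableS k2); apply: degenerate_colorable.
  - exact: edge_rel_sym.
  - exact: edge_rel_irr.
  move=> A _ A0; apply: leq_ltn_trans (arcs_le_edges G A) _.
  have := sp A; have : (0 < #|A|)%N by rewrite card_gt0.
  by move=> cA; rewrite (maxn_idPr cA) ltn_pmul2l.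
apply: le_lt_trans (_ : 2^-1 < 1); last by lra.
apply: (@sum_le_half R (fun s => 'C(n, s)%:R * ('C('C(s, 2%N), maxn 1 s)%:R * w ^+ maxn 1 s))).
  by rewrite maxn0 bin0n /= bin0n /= mul0r mulr0.
move=> s s0; rewrite (maxn_idPr s0).
apply: le_trans (first_moment_term _ _ _ (ltW w0)) _.
rewrite -exprMn ler_pXn2r ?nnegrE ?invr_ge0 //.
  suff -> : expR 1 * n%:R / s%:R * (expR 1 * s%:R ^+ 2 * w / (2 * s%:R)) =
     expR 1 ^+ 2 * n%:R * w / 2 by [].
  by field; rewrite pnatr_eq0 -lt0n.
by rewrite !mulr_ge0 ?invr_ge0 ?mulr_ge0 ?exprn_ge0 // ltW.
Qed.

Section ClientManyColors.

Variables (R : realType) (k n q : nat).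
Let K : R := k%:R.
Let L : R := ln K.
(** The square root of [K]. *)
Let r : R := expR (L / 2).
Let N : R := n%:R.

Hypotheses (k_gt0 : (0 < k)%N) (L_ge : 100 <= L).
Hypothesis n_ge : 4 * r * (K * L) ^+ 3 + 12 * K + 1 <= N.
Hypothesis q_ge : 8 * expR 1 * N / (K * L) <= q%:R.

Let K_gt0 : 0 < K. Proof. by rewrite ltr0n. Qed.
Let L_gt0 : 0 < L. Proof. exact: lt_le_trans L_ge. Qed.
Let r_gt0 : 0 < r. Proof. exact: expR_gt0. Qed.
Let rr : r * r = K.
Proof.
have E : L / 2 + L / 2 = L by lra.
by rewrite /r -expRD E lnK ?posrE.
Qed.
Let KL_gt0 : 0 < K * L. Proof. by rewrite mulr_gt0. Qed.
Let N_gt0 : 0 < N.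
Proof.
apply: lt_le_trans n_ge; apply: ltr_wpDl => //.
by rewrite addr_ge0 // !mulr_ge0 ?exprn_ge0 // ltW.
Qed.

Let r_ge : L * L / 16 <= r.
Proof.
have -> : r = expR (L / 4) ^+ 2 by rewrite -expRM_natr; congr expR; field.
have -> : L * L / 16 = (L / 4) ^+ 2 by field.
rewrite ler_pXn2r ?nnegrE ?expR_ge0 ?divr_ge0 ?(ltW L_gt0) //.
by have := expR_ge1Dx (L / 4); lra.
Qed.

Let r_ge100 : 100 <= r.
Proof.
have : 100 * 100 <= L * L by apply: ler_pM.
by have := r_ge; lra.
Qed.

Let rL_ge : 100 * r <= r * L. Proof. by rewrite mulrC ler_pM2l. Qed.

Let e_ge2 : 2 <= expR 1 :> R.
Proof. by have := expR_ge1Dx (1 : R); lra. Qed.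

Let M (s : R) : R := Num.max s (N / r).

(* The average degree allowed in a set of [s] vertices: 3/2 times [e] times the
   average degree of a random graph of density [1 / Q], [Q = 8 e N / (K L)],
   with small sets treated as if they had [N / r] vertices. *)
Let D (s : R) : R := 3 / 16 * (K * L) * M s / N.

(** The least integer above [s * D s / 2]: fewer edges mean average degree at most [D s]. *)
Let m (s : nat) : nat := (Num.truncn (s%:R * D s%:R / 2)).+1.

Let w : R := q.+1%:R^-1.

Let w_gt0 : 0 < w. Proof. by rewrite invr_gt0 ltr0n. Qed.

Let w_le : expR 1 * w <= K * L / (8 * N).
Proof.
have Q0 : 0 < 8 * expR 1 * N / (K * L) by rewrite divr_gt0 // !mulr_gt0 // expR_gt0.
have : w <= (8 * expR 1 * N / (K * L))^-1.
  rewrite /w lef_pV2 ?posrE ?ltr0n //; apply: le_trans q_ge _.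
  by rewrite ler_nat.
move=> /(ler_wpM2l (ltW (expR_gt0 1))) /le_trans; apply.
rewrite invf_div le_eqVlt; apply/orP; left; apply/eqP; field.
by rewrite !gt_eqF ?expR_gt0 // KL_gt0.
Qed.

Let M_ge s : N / r <= M s. Proof. by rewrite le_max lexx orbT. Qed.
Let M_gt0 s : 0 < M s. Proof. by apply: lt_le_trans (M_ge s); rewrite divr_gt0. Qed.
Let D_gt0 s : 0 < D s. Proof. by rewrite divr_gt0 // !mulr_gt0. Qed.

Let D_ge s : 3 / 16 * r * L <= D s.
Proof.
rewrite /D ler_pdivlMr // -rr.
have := M_ge s; rewrite ler_pdivrMr // => H.
have -> : 3 / 16 * (r * r * L) * M s = 3 / 16 * r * L * (M s * r) by ring.
by apply: ler_wpM2l H; rewrite !mulr_ge0 // ltW.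
Qed.

Let m_gt s : s%:R * D s%:R / 2 < (m s)%:R.
Proof. exact: truncnS_gt. Qed.

Let m_ge s : (s <= m s)%N.
Proof.
rewrite -(ler_nat R); apply: le_trans (ltW (m_gt s)).
rewrite -mulrA ler_peMr //; have := D_ge s%:R; have := rL_ge; have := r_ge100; lra.
Qed.

Let moment_le s : (0 < s)%N ->
  'C(n, s)%:R * ('C('C(s, 2%N), m s)%:R * w ^+ m s) <= 4^-1 ^+ s.
Proof.
move=> s0; have S0 : 0 < s%:R :> R by rewrite ltr0n.
apply: le_trans (first_moment_term _ _ _ (ltW w_gt0)) _.
have m0 : 0 < (m s)%:R :> R by rewrite ltr0n.
set Ms := M s%:R; have Ms0 : 0 <= Ms := ltW (M_gt0 _).
(* The 2/3 is the inverse of the factor 3/2 in [D]. *)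
have base : expR 1 * s%:R ^+ 2 * w / (2 * (m s)%:R) <= (s%:R / Ms) * (2 / 3).
  rewrite ler_pdivrMr ?mulr_gt0 //.
  apply: (@le_trans _ _ (s%:R / Ms * (2 / 3) * (s%:R * D s%:R))); last first.
    apply: ler_wpM2l; first by rewrite !mulr_ge0 ?invr_ge0.
    by have := m_gt s; lra.
  have -> : s%:R / Ms * (2 / 3) * (s%:R * D s%:R) = s%:R ^+ 2 * (K * L / (8 * N)).
    by rewrite /D -/Ms; field; rewrite !gt_eqF // M_gt0.
  have -> : expR 1 * s%:R ^+ 2 * w = s%:R ^+ 2 * (expR 1 * w) by ring.
  by apply: ler_wpM2l w_le; apply: exprn_ge0.
apply: (@le_trans _ _ ((expR 1 * N / s%:R) ^+ s * ((s%:R / Ms) ^+ s * expR (- (s%:R * D s%:R / 6))))).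
  apply: ler_wpM2l; first by rewrite exprn_ge0 // !mulr_ge0 ?invr_ge0 ?expR_ge0.
  apply: (@le_trans _ _ ((s%:R / Ms * (2 / 3)) ^+ m s)).
    rewrite ler_pXn2r ?nnegrE //; last by rewrite !mulr_ge0 ?invr_ge0.
    by rewrite !mulr_ge0 ?exprn_ge0 ?invr_ge0 ?expR_ge0 ?mulr_ge0.
  rewrite exprMn; apply: ler_pM; try by rewrite exprn_ge0 // !mulr_ge0 ?invr_ge0.
    (* Since [s <= Ms], the exponent may drop to [s]; the power then cancels [s ^ s] in the bound on
       the binomial coefficient. *)
    apply: ler_wiXn2l (m_ge s); first by rewrite mulr_ge0 ?invr_ge0.
    by rewrite ler_pdivrMr ?M_gt0 // mul1r le_max lexx.
  apply: (@le_trans _ _ (expR (- (1 / 3)) ^+ m s)).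
    rewrite ler_pXn2r ?nnegrE ?expR_ge0 ?divr_ge0 //.
    by have := expR_ge1Dx (- (1 / 3) : R); lra.
  rewrite -expRM_natr ler_expR; have := m_gt s; lra.
have -> : expR (- (s%:R * D s%:R / 6)) = expR (- (D s%:R / 6)) ^+ s.
  by rewrite -expRM_natr; congr expR; ring.
rewrite -!exprMn ler_pXn2r ?nnegrE ?invr_ge0 //; last first.
  by rewrite !mulr_ge0 ?invr_ge0 ?expR_ge0.
have -> : expR 1 * N / s%:R * (s%:R / Ms * expR (- (D s%:R / 6))) =
    (N / Ms) * (expR 1 * expR (- (D s%:R / 6))).
  by field; rewrite !gt_eqF // M_gt0.
have NM : N / Ms <= r.
  rewrite ler_pdivrMr ?M_gt0 // mulrC.
  by have := M_ge s%:R; rewrite ler_pdivrMr.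
apply: le_trans (ler_wpM2r _ NM) _; first by rewrite mulr_ge0 ?expR_ge0.
rewrite /r -!expRD.
(* [D / 6] is at least [r * L / 32 >= 100 * L / 32], which outweighs [L / 2 + 3]. *)
apply: (@le_trans _ _ (expR (- 2))).
  have : 100 * L <= r * L by rewrite ler_pM2r.
  rewrite ler_expR; have := D_ge s%:R; have := L_ge; lra.
rewrite expRN lef_pV2 ?posrE ?expR_gt0 //.
have -> : (2 : R) = 1 * 2%:R by rewrite mul1r.
rewrite expRM_natr; have := e_ge2; nra.
Qed.

(** Triangles then have expected weight at most 1/4, and Client gets fewer than [4 * (K * L) ^+ 3]
    of them. *)
Let lam : R := 4^-1 * (K * L) ^- 3.

Let lam_gt0 : 0 < lam.
Proof. by rewrite mulr_gt0 // invr_gt0 exprn_gt0. Qed.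

Lemma client_locally_sparse :
  client_can_maintain (complete_edges n) q (fun G =>
    lam * #|triangles G|%:R < 1 /\
    forall S, (#|G :&: inner_edges S| < m #|S|)%N).
Proof.
apply: client_sparse; first exact: ltW.
have H : lam * n%:R ^+ 3 * w ^+ 3 <= 4^-1.
  have -> : lam * n%:R ^+ 3 * w ^+ 3 = 4^-1 * (N * w / (K * L)) ^+ 3.
    by rewrite /lam -/N; field; rewrite !gt_eqF.
  rewrite ler_piMr // exprn_ile1 //.
    by rewrite !mulr_ge0 ?invr_ge0 // ltW.
  rewrite ler_pdivrMr // mul1r.
  have : w <= K * L / (8 * N).
    by apply: le_trans w_le; rewrite ler_peMl ?(ltW w_gt0) //; have := e_ge2; lra.
  rewrite ler_pdivlMr ?mulr_gt0 // => H.
  have : 0 <= N * w by rewrite mulr_ge0 // ltW.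
  by move: H; lra.
have m0 : 'C('C(0, 2%N), m 0) = 0%N by rewrite bin0n bin_small.
have H2 : \sum_(s < n.+1) 'C(n, s)%:R * ('C('C(s, 2%N), m s)%:R * w ^+ m s) <= 2^-1.
  apply: (@sum_le_half R
    (fun s => 'C(n, s)%:R * ('C('C(s, 2%N), m s)%:R * w ^+ m s)) n _ moment_le).
  by rewrite m0 mul0r mulr0.
have lt1 : 4^-1 + 2^-1 < 1 :> R by lra.
exact: le_lt_trans (lerD H H2) lt1.
Qed.

Lemma client_many_colors : client_can_maintain (complete_edges n) q (@colorable n k).
Proof.
apply: client_can_maintain_mono client_locally_sparse => G [tri sp].
have arcs_le (A : {set 'I_n}) : (arcs (edge_rel G) A A)%:R <= D #|A|%:R * #|A|%:R.
  apply: (@le_trans _ _ (2 * #|G :&: inner_edges A|)%:R); first by rewrite ler_nat arcs_le_edges.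
  have := sp A; rewrite ltnS -(ler_nat R) natrM => H.
  have H2 : (Num.truncn (#|A|%:R * D #|A|%:R / 2))%:R <= #|A|%:R * D #|A|%:R / 2.
    by rewrite truncn_le divr_ge0 // mulr_ge0 //; apply: ltW.
  by have := le_trans H H2; lra.
have [W cW tf] := triangle_hitting_set G.
have W_le : #|W|%:R <= N / r.
  apply: (@le_trans _ _ #|triangles G|%:R); first by rewrite ler_nat.
  rewrite ler_pdivlMr //; move: tri; rewrite /lam mulrC mulrA ltr_pdivrMr ?exprn_gt0 //.
  rewrite mul1r ltr_pdivrMr // => tri.
  have : #|triangles G|%:R * r <= (K * L) ^+ 3 * 4 * r by rewrite ler_wpM2r // ltW.
  have := n_ge; have := K_gt0; lra.
(* Sets of more than [N / r] vertices have stable sets of size [4 N / (3 K)]; sets of at most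
   [2 N / r] vertices have average degree at most [3 r L / 8]. *)
apply: (@sparse_colorable n G W (Num.truncn (4 / 3 * N / K)) (Num.truncn (N / r)).+1
   (Num.truncn (3 / 8 * r * L))) => //.
- rewrite truncn_gt0 ler_pdivlMr // mul1r; have := n_ge.
  have : 0 <= 4 * r * (K * L) ^+ 3 by rewrite !mulr_ge0 ?exprn_ge0 // ltW.
  have := K_gt0; lra.
- move=> A tfA cA.
  have cA' : N / r < #|A|%:R.
    by rewrite -truncn_lt_nat // divr_ge0 // ltW.
  have A0 : 0 < #|A|%:R :> R by apply: lt_trans cA'; rewrite divr_gt0.
  have [|B sB [stB leB]] := @stable_set_ge R _ (edge_rel G) A (D #|A|%:R)
     (@edge_rel_sym _ G) (@edge_rel_irr _ G) tfA _ (D_gt0 _) (arcs_le A).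
    by rewrite -(ltr0n R).
  exists B => //; split=> //.
  have ME : M #|A|%:R = #|A|%:R by rewrite /M; apply/max_idPl; apply: ltW.
  have lnD : L / 2 <= ln ((1 + D #|A|%:R) / 2).
    rewrite -[leLHS]expRK -/r ler_ln ?posrE //; last first.
      by rewrite divr_gt0 // addr_gt0.
    rewrite ler_pdivlMr //; have := D_ge #|A|%:R; have := rL_ge; have := r_ge100; lra.
  have : #|A|%:R * (L / 2) / D #|A|%:R <= 2 * #|B|%:R.
    apply: le_trans leB; apply: ler_wpM2r; first by rewrite invr_ge0 ltW.
    by apply: ler_wpM2l => //; apply: ltW.
  have -> : #|A|%:R * (L / 2) / D #|A|%:R = 8 / 3 * N / K.
    by rewrite /D ME; field; rewrite !gt_eqF.
  move=> leB'; rewrite -(ler_nat R).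
  have : (Num.truncn (4 / 3 * N / K))%:R <= 4 / 3 * N / K.
    by rewrite truncn_le divr_ge0 ?(ltW K_gt0) // mulr_ge0 // ltW.
  lra.
- move=> A A0 cA.
  have cA' : #|A|%:R <= 2 * (N / r).
    have : (#|A| <= Num.truncn (N / r) + #|W|)%N by rewrite -ltnS -addSn.
    have H : (Num.truncn (N / r))%:R <= N / r by rewrite truncn_le ltW // divr_gt0.
    by rewrite -(ler_nat R) natrD; lra.
  have A1 : 0 < #|A|%:R :> R by rewrite ltr0n card_gt0.
  rewrite -(ltr_nat R) natrM; apply: le_lt_trans (arcs_le A) _.
  rewrite ltr_pM2r //; apply: le_lt_trans (truncnS_gt _).
  have Nr : 0 < N / r by rewrite divr_gt0.
  have ML : M #|A|%:R <= 2 * (N / r) by rewrite ge_max cA'; lra.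
  rewrite /D ler_pdivrMr //.
  apply: le_trans (ler_wpM2l _ ML) _; first by rewrite mulr_ge0 // ltW.
  by rewrite -rr le_eqVlt; apply/orP; left; apply/eqP; field; rewrite gt_eqF.
(* Rounding weakens 4/3 to 5/4, so peeling takes at most [4 K / 5] colours. The greedy part takes at
   most [3 K / 16 + 1], and [K >= 100] makes the total at most [K]. *)
- move=> c cn; rewrite -(ler_nat R) natrD -natr1.
  have a_gt := truncnS_gt (4 / 3 * N / K).
  have t_le : (Num.truncn (3 / 8 * r * L))%:R <= 3 / 8 * r * L.
    by rewrite truncn_le ltW // !mulr_gt0.
  have a_ge : 5 / 4 * N / K <= (Num.truncn (4 / 3 * N / K))%:R.
    have : 1 <= (4 / 3 - 5 / 4) * N / K.
      rewrite ler_pdivlMr // mul1r; have := n_ge.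
      have : 0 <= 4 * r * (K * L) ^+ 3 by rewrite !mulr_ge0 ?exprn_ge0 // ltW.
      lra.
    by move: a_gt; rewrite -natr1; lra.
  have c_le : c%:R <= 4 / 5 * K.
    move: cn; rewrite -(ler_nat R) natrM => cn.
    have : c%:R * (5 / 4 * N / K) <= N by apply: le_trans cn; apply: ler_wpM2l.
    have -> : c%:R * (5 / 4 * N / K) = N * (c%:R / (4 / 5 * K)) by field; rewrite gt_eqF.
    by rewrite ger_pMr // ler_pdivrMr ?mulr_gt0 // mul1r.
  have rL : 2 * (r * L) <= K.
    rewrite -rr mulrCA ler_pM2l //.
    have : 100 * L <= L * L by rewrite ler_pM2r.
    by have := r_ge; have := L_gt0; lra.
  have K_ge : 100 <= K.
    have : 100 * r <= r * r by rewrite ler_pM2r.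
    by have := r_ge100; rewrite -rr; lra.
  rewrite -/K; lra.
Qed.

End ClientManyColors.

(** * Waiter's side *)

Section WaiterManyColors.

Variables (R : realType) (k n q : nat).
Let K : R := k%:R.
Let L : R := ln K.
Let N : R := n%:R.

Hypotheses (k_gt0 : (0 < k)%N) (q_gt0 : (0 < q)%N) (L_ge : 100 <= L).
Hypothesis n_ge : 12 * K ^+ 3 + 3 * K + 2 <= N.
Hypothesis q_le : q%:R <= ln 2 / 4 * N / (K * L).

Lemma waiter_many_colors :
  waiter_can_force (complete_edges n) q (fun G => ~ colorable k G).
Proof.
have K0 : 0 < K by rewrite ltr0n.
have L0 : 0 < L by apply: lt_le_trans L_ge.
have K30 : 0 < K ^+ 3 by rewrite exprn_gt0.
have N0 : 2 <= N by move: n_ge; lra.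
have n0 : (2 <= n)%N by rewrite -(ler_nat R).
have q0 : 0 < q%:R :> R by rewrite ltr0n.
have l20 : 0 < ln 2 :> R by rewrite ln_gt0 // ltr1n.
have lamq : expR (ln 2 / q%:R) ^+ q = 2 :> R.
  by rewrite -expRM_natr divfK ?gt_eqF // lnK ?posrE.
(* [s + 1] is [n / k] rounded up. *)
pose s := (n.-1 %/ k)%N; set S : R := s.+1%:R.
apply: (@waiter_not_colorable n R k q s (expR (ln 2 / q%:R))) => //.
- by rewrite -[leLHS]expR0 ler_expR divr_ge0 // ltW.
- by have := leq_divM n.-1 k; rewrite -/s; lia.
have SK : N <= S * K.
  rewrite -natrM ler_nat; have := ltn_ceil n.-1 k_gt0; rewrite -/s; lia.
have S3 : 3 <= S.
  rewrite -(ler_pM2r K0); move: n_ge SK; lra.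
have rounds_le : (#|complete_edges n| %/ q.+1).+1%:R <= N ^+ 2.
  have -> : #|complete_edges n| = 'C(n, 2%N).
    by rewrite /complete_edges card_draws card_ord.
  rewrite -natrX ler_nat.
  have b2 : (2 * 'C(n, 2) <= n ^ 2)%N.
    by rewrite mul_bin_left bin1 expnS expn1 leq_mul // leq_subr.
  have : (2 * 2 <= n ^ 2)%N by rewrite expnS expn1 leq_mul.
  have := leq_div 'C(n, 2) q.+1; lia.
(* The hypothesis on [q] gives [ln 2 / q >= 4 K L / N], and [S * K >= N] turns the exponent
   [(S - 1) * S / 2] into a gain of [2 L (S - 1)]. *)
have clique : 'C(n, s.+1)%:R * expR (ln 2 / q%:R) ^- 'C(s.+1, 2%N)
    <= expR (S * (1 + L) - 2 * L * (S - 1)).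
  rewrite expRD; apply: ler_pM; rewrite ?ler0n ?invr_ge0 ?exprn_ge0 ?expR_ge0 //.
    apply: (@le_trans _ _ ((expR 1 * N / S) ^+ s.+1)); first exact: bin_le_exp.
    rewrite [expR (S * _)]expRM_natl expRD lnK ?posrE // ler_pXn2r ?nnegrE.
    - by rewrite -mulrA ler_pM2l ?expR_gt0 // ler_pdivrMr ?ltr0n // mulrC.
    - by [].
    - by rewrite !mulr_ge0 ?expR_ge0 ?invr_ge0.
    - by rewrite mulr_ge0 ?expR_ge0 // ltW.
  rewrite -expRM_natr expRN lef_pV2 ?posrE ?expR_gt0 // ler_expR.
  have -> : 'C(s.+1, 2%N)%:R = (S - 1) * S / 2.
    have := mul_bin_left s.+1 1; rewrite bin1 => /(congr1 (fun j => j%:R : R)).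
    by rewrite !natrM natrB // -/S; lra.
  have lq : 4 * K * L / N <= ln 2 / q%:R.
    have N1 : 0 < N by apply: lt_le_trans N0.
    rewrite ler_pdivlMr // mulrAC ler_pdivrMr //; move: q_le.
    rewrite ler_pdivlMr ?mulr_gt0 //; lra.
  have S1 : 0 <= S - 1 by lra.
  apply: (@le_trans _ _ (4 * K * L / N * ((S - 1) * S / 2))); last first.
    by apply: ler_wpM2r lq; rewrite !mulr_ge0.
  have -> : 4 * K * L / N * ((S - 1) * S / 2) = 2 * L * (S - 1) * (S * K / N).
    by field; rewrite gt_eqF // (lt_le_trans _ N0).
  rewrite ler_peMr //; first by rewrite !mulr_ge0 // ltW.
  by rewrite ler_pdivlMr ?mul1r // (lt_le_trans _ N0).
(* The exponent is at least [S >= N / K], and the cubic term of the exponential series beats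
   [2 * N ^+ 2] because [N > 12 * K ^+ 3]. *)
have key : 2 * N ^+ 2 < expR (S * (L - 1) - 2 * L).
  have N1 : 0 < N by apply: lt_le_trans N0.
  have yS : N / K <= S * (L - 1) - 2 * L.
    apply: (@le_trans _ _ S); first by rewrite ler_pdivrMr.
    have : 3 * (L - 2) <= S * (L - 2) by apply: ler_wpM2r => //; move: L_ge; lra.
    move: L_ge; lra.
  have NK : 0 <= N / K by rewrite divr_ge0 // ltW.
  apply: lt_le_trans (_ : expR (N / K) <= _); last by rewrite ler_expR.
  have := @expR_ge1Dxn R (N / K) 2 NK; apply: lt_le_trans.
  apply: (@le_lt_trans _ _ ((N / K) ^+ 3 / 6)); last first.
    by rewrite (_ : (3`! = 6)%N) // ltrDr.
  rewrite ler_pdivlMr // expr_div_n ler_pdivlMr //.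
  have -> : 2 * N ^+ 2 * 6 * K ^+ 3 = N ^+ 2 * (12 * K ^+ 3) by ring.
  rewrite [N ^+ 3]exprSr ler_pM2l ?exprn_gt0 //; move: n_ge; lra.
rewrite -mulrA; apply: le_lt_trans (_ : 2 * (N ^+ 2 * expR (S * (1 + L) - 2 * L * (S - 1))) < 1).
  by apply: ler_wpM2l => //; apply: ler_pM.
have -> : S * (1 + L) - 2 * L * (S - 1) = - (S * (L - 1) - 2 * L) by ring.
by rewrite expRN mulrA ltr_pdivrMr ?expR_gt0 // mul1r.
Qed.

End WaiterManyColors.

(** * The choice of [alpha] and the combination of both sides *)

Theorem theorem1p6 (R : realType) :
  exists alpha : nat -> R,
    [/\ forall k : nat, (2 <= k)%N -> 0 < alpha k,
        alpha k @[k --> \oo] --> (0 : R)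
      & forall k : nat, (2 <= k)%N ->
        exists n0 : nat, forall n : nat, (n0 <= n)%N ->
          (forall q : nat,
             (8 * expR 1 + alpha k) * n%:R / (k%:R * ln k%:R) <= q%:R ->
             client_can_maintain (complete_edges n) q (@colorable n k)) /\
          (forall q : nat, (0 < q)%N ->
             q%:R <= (ln 2 / 4 - alpha k) * n%:R / (k%:R * ln k%:R) ->
             waiter_can_force (complete_edges n) q
               (fun G => ~ colorable k G))].
Proof.
pose large (k : nat) := 100 <= ln k%:R :> R.
(* For large [k] any positive sequence tending to 0 serves. For small [k] the first summand gives
   [q >= 2 e^2 n], and the 1 makes [ln 2 / 4 - alpha k] negative. *)
exists (fun k => if large k then k%:R^-1 else 2 * expR 1 ^+ 2 * (k%:R * ln k%:R) + 1).
have L0 k : (2 <= k)%N -> 0 < k%:R * ln k%:R :> R.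
  by move=> k2; rewrite mulr_gt0 ?ln_gt0 ?ltr0n ?ltr1n //; apply: ltn_trans k2.
split.
- move=> k k2; case: ifP => _; first by rewrite invr_gt0 ltr0n (ltn_trans _ k2).
  apply: ltr_wpDl => //; apply: mulr_ge0; last exact: ltW (L0 k k2).
  by rewrite mulr_ge0 ?exprn_ge0 ?expR_ge0.
- apply/cvgrPdist_lt => e e0; near=> k.
  have kE : expR 100 <= k%:R :> R by near: k; exact: nbhs_infty_ger.
  have ke : e^-1 < k%:R by near: k; exact: nbhs_infty_gtr.
  have k0 : 0 < k%:R :> R by apply: lt_le_trans kE; exact: expR_gt0.
  have -> : large k by rewrite /large -(@expRK R 100) ler_ln ?posrE ?expR_gt0.
  by rewrite sub0r normrN gtr0_norm ?invr_gt0 // -[ltRHS]invrK ltf_pV2 ?posrE ?invr_gt0.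
move=> k k2; have k0 : (0 < k)%N by apply: ltn_trans k2.
have KL0 := L0 k k2; set K : R := k%:R in KL0 *.
case: ifPn => [big|]; last first.
  rewrite /large -ltNge -/K => _; exists 1%N => n n0.
  split=> q; last first.
    move=> q0 qle; exfalso.
    suff : q%:R <= 0 :> R by rewrite leNgt ltr0n q0.
    apply: le_trans qle _; rewrite mulr_le0_ge0 ?invr_ge0 ?(ltW KL0) //.
    rewrite mulr_le0_ge0 //.
    have : ln 2 <= 1 :> R by have := @le_ln1Dx R 1; rewrite (_ : 1 + 1 = 2 :> R) //; apply; lra.
    have : 0 <= 2 * expR 1 ^+ 2 * (K * ln K) :> R.
      apply: mulr_ge0; last exact: ltW.
      by rewrite mulr_ge0 ?exprn_ge0 ?expR_ge0.
    lra.
  move=> qge; apply: (@client_two_colorable R) => //; apply: le_trans qge.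
  rewrite ler_pdivlMr //.
  have : 0 <= (8 * expR 1 + 1) * n%:R :> R by rewrite mulr_ge0 // addr_ge0 // mulr_ge0 // expR_ge0.
  lra.
pose A : R := 4 * expR (ln K / 2) * (K * ln K) ^+ 3 + 12 * K + 1.
pose B : R := 12 * K ^+ 3 + 3 * K + 2.
exists (maxn (Num.truncn A).+1 (Num.truncn B).+1) => n; rewrite geq_max => /andP[nA nB].
have {}nA : A <= n%:R by apply: le_trans (ltW (truncnS_gt A)) _; rewrite ler_nat.
have {}nB : B <= n%:R by apply: le_trans (ltW (truncnS_gt B)) _; rewrite ler_nat.
have Ki : 0 <= K^-1 * n%:R / (K * ln K) by rewrite !mulr_ge0 ?invr_ge0 // ltW.
split=> [q qge|q q0 qle].
  apply: (@client_many_colors R) => //; apply: le_trans qge.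
  by rewrite -/K; lra.
apply: (@waiter_many_colors R) => //; apply: le_trans qle _.
by rewrite -/K; lra.
Unshelve. all: by end_near.
Qed.
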